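(* Let $X\subset\mathrm{Hol}(\mathbb{D})$ be a complex Banach space of holomorphic functions on $\mathbb{D}$ (a linear subspace of $\mathrm{Hol}(\mathbb{D})$ equipped with a complete norm $\|\cdot\|_X$) such that: (X1) the inclusion map $X\to\mathrm{Hol}(\mathbb{D})$ is continuous; (X2) the polynomials are contained in $X$ and are dense in $X$; (X3) $\limsup_{n\to\infty}\|z^n\|_X^{1/n}\le 1$. Let $T:X\to\mathrm{Hol}(\mathbb{D})$ be a continuous linear map that maps finite Blaschke products to inner functions and satisfies $\dim(T(X))>1$, and let $\phi,\psi$ be inner functions, with $\phi$ non-constant, such that $Tf=\psi\cdot(f\circ\phi)$ for all $f\in X$. (i) If $T(X\cap N^+)$ contains an outer function, then $\psi$ is a unimodular constant. (ii) If, further (that is, in addition to the hypothesis of (i)), $T(X)$ separates points of $\mathbb{D}$, then $\phi$ is an automorphism of $\mathbb{D}$.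
   Context: $\mathbb{D}$ is the open unit disk in $\mathbb{C}$ and $\mathbb{T}$ is the unit circle. $\mathrm{Hol}(\mathbb{D})$ is the space of holomorphic functions on $\mathbb{D}$ with the topology of uniform convergence on compact sets. A function $h\in\mathrm{Hol}(\mathbb{D})$ is called inner if it is bounded and its radial limits $h^*(e^{it}):=\lim_{r\to1^-}h(re^{it})$ satisfy $|h^*(e^{it})|=1$ for a.e. $e^{it}\in\mathbb{T}$. In particular unimodular constants are inner, and a non-constant inner function maps $\mathbb{D}$ into $\mathbb{D}$. A finite Blaschke product is a function of the form $B(z)=c\prod_{n=1}^{N}\frac{a_n-z}{1-\overline{a_n}z}$ with $N\ge 0$, $a_1,\dots,a_N\in\mathbb{D}$ and $c$ a unimodular constant (so unimodular constants, $N=0$, are included). The conditions (X1)--(X3) imply that $X$ contains all rational functions with poles outside $\overline{\mathbb{D}}$, and in particular all finite Blaschke products. A function $g\in\mathrm{Hol}(\mathbb{D})$ is called outer if there exists $G:\mathbb{T}\to[0,\infty)$ with $\log G\in L^1(\mathbb{T})$ such that $g(z)=\exp\Bigl(\int_0^{2\pi}\frac{e^{it}+z}{e^{it}-z}\log G(e^{it})\,\frac{dt}{2\pi}\Bigr)$ for all $z\in\mathbb{D}$. The Smirnov class $N^+$ is the set of all functions $f$ expressible as $f=hg$ with $h$ inner and $g$ outer, together with the function $f\equiv0$. A set $F$ of functions on $\mathbb{D}$ separates points of $\mathbb{D}$ if for any distinct $z,w\in\mathbb{D}$ there is $f\in F$ with $f(z)\ne f(w)$. An automorphism of $\mathbb{D}$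 is a biholomorphic map of $\mathbb{D}$ onto itself. *)

(* Defs.v *)
(* Complex numbers are [R[i]], for [R : realType]; the alias [R[i]^o] carries
   their norm and topology. *)
From HB Require Import structures.
From mathcomp Require Import all_boot all_order all_algebra.
From mathcomp Require Import all_classical all_reals all_analysis.
From mathcomp Require Import complex.

Set Implicit Arguments.
Unset Strict Implicit.
Unset Printing Implicit Defensive.

Import Order.TTheory GRing.Theory Num.Theory.
Import numFieldNormedType.Exports.

Local Open Scope classical_set_scope.
Local Open Scope ring_scope.
Local Open Scope complex_scope.

Definition disk {R : realType} : set R[i]^o := [set z | `|z| < 1].

(* A function on the disk is represented by a total function on [R[i]] whose
   values outside the disk are irrelevant: every definition below only looks at
   values on the disk, and equality of functions is equality on the disk. *)
Definition eq_disk {R : realType} (f g : R[i]^o -> R[i]^o) : Prop :=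
  {in disk, f =1 g}.

(* The increment tends to 0 in [R[i]], so this is complex differentiability. *)
Definition holomorphic {R : realType} (f : R[i]^o -> R[i]^o) : Prop :=
  forall z, disk z -> derivable f z 1.

(* The topology of uniform convergence on compact subsets of the disk. On total
   functions it is not Hausdorff: it identifies functions equal on the disk. *)
Notation compact_convergence R :=
  {family compactly_in (@disk R), R[i]^o -> R[i]^o}.

Definition cis {R : realType} (t : R) : R[i]^o := cos t +i* sin t.

Definition cexp {R : realType} (z : R[i]) : R[i]^o :=
  (expR (complex.Re z))%:C * cis (complex.Im z).

(* Lebesgue integral over [0, 2 pi] of a complex-valued function. *)
Definition integral_0_2pi {R : realType} (f : R -> R[i]) : R[i] :=
  (\int[lebesgue_measure]_(t in `[0, 2 * pi]) complex.Re (f t)) +i*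
  (\int[lebesgue_measure]_(t in `[0, 2 * pi]) complex.Im (f t)).

Definition inner {R : realType} (h : R[i]^o -> R[i]^o) : Prop :=
  [/\ holomorphic h,
      exists M : R, forall z, disk z -> `|h z| <= M%:C
    & \forall t \ae (@lebesgue_measure R), t \in `[0, 2 * pi] ->
        exists2 l : R[i]^o,
          h (r%:C * cis t) @[r --> (1 : R)^'-] --> l & `|l| = 1].

(* Integrability is that of the extended real logarithm [lne], with
   [lne 0 = -oo], and so forces G > 0 almost everywhere; the real logarithm in
   the integral, for which [ln 0 = 0], then differs from it on a null set. *)
Definition outer {R : realType} (g : R[i]^o -> R[i]^o) : Prop :=
  holomorphic g /\
  exists G : R[i]^o -> R,
    [/\ forall w, `|w| = 1 -> 0 <= G w,
        lebesgue_measure.-integrable `[0, 2 * pi]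
          (fun t : R => lne (G (cis t))%:E)
      & forall z, disk z ->
          g z = cexp ((2 * pi)^-1%:C *
                      integral_0_2pi (fun t => (cis t + z) / (cis t - z) *
                                               (ln (G (cis t)))%:C))].

Definition smirnov {R : realType} (f : R[i]^o -> R[i]^o) : Prop :=
  (exists h g, [/\ inner h, outer g & eq_disk f (fun z => h z * g z)]) \/
  eq_disk f (fun=> 0).

Definition finite_blaschke {R : realType} (B : R[i]^o -> R[i]^o) : Prop :=
  exists (c : R[i]^o) (s : seq R[i]^o),
    [/\ `|c| = 1, forall a, a \in s -> disk a
      & eq_disk B (fun z => c * \prod_(a <- s) ((a - z) / (1 - conjc a * z)))].

Definition constant_on_disk {R : realType} (f : R[i]^o -> R[i]^o) : Prop :=
  exists c, eq_disk f (fun=> c).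

Definition unimodular_constant {R : realType} (f : R[i]^o -> R[i]^o) : Prop :=
  exists2 c : R[i]^o, `|c| = 1 & eq_disk f (fun=> c).

Definition separates_points {R : realType} (F : set (R[i]^o -> R[i]^o)) : Prop :=
  forall z w, disk z -> disk w -> z <> w -> exists2 f, F f & f z <> f w.

Definition disk_automorphism {R : realType} (f : R[i]^o -> R[i]^o) : Prop :=
  [/\ holomorphic f, set_fun disk disk f
    & exists g, [/\ holomorphic g, set_fun disk disk g,
                    {in disk, cancel f g} & {in disk, cancel g f}]].

(* Linear independence of functions restricted to the disk. *)
Definition free_on_disk {R : realType} n (f : 'I_n -> R[i]^o -> R[i]^o) : Prop :=
  forall a : 'I_n -> R[i],
    eq_disk (fun z => \sum_(i < n) a i * f i z) (fun=> 0) -> forall i, a i = 0.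

(* [n < dim W] for a linear space [W] of functions on the disk. *)
Definition dim_gt {R : realType} (n : nat) (W : set (R[i]^o -> R[i]^o)) : Prop :=
  exists2 f : 'I_n.+1 -> R[i]^o -> R[i]^o, forall i, W (f i) & free_on_disk f.

(* A Banach space of holomorphic functions on the disk is given by a Banach
   space [X] and a linear map [iota], the inclusion in the space of holomorphic
   functions, which sends an element of [X] to the function it is. *)
Section BanachSpace.
Context {R : realType} (X : completeNormedModType R[i]).
Variable iota : {linear X -> (R[i]^o -> R[i]^o)}.

Definition function_space : Prop :=
  (forall f, holomorphic (iota f)) /\
  (forall f g, eq_disk (iota f) (iota g) -> f = g).

Definition is_polynomial : set X :=
  [set f | exists p : {poly R[i]}, eq_disk (iota f) (horner p)].

Definition inclusion_continuous : Prop :=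
  continuous (iota : X -> compact_convergence R).

Definition polynomials_dense : Prop :=
  (forall p : {poly R[i]}, exists f, eq_disk (iota f) (horner p)) /\
  dense is_polynomial.

(* The norm of [X] has its values in the nonnegative real elements of [R[i]],
   hence the real part; [monomial n] is the function z ^ n, seen in [X]. *)
Definition monomial_growth : Prop :=
  exists2 monomial : nat -> X,
    forall n, eq_disk (iota (monomial n)) (fun z => z ^+ n)
    & (limn_esup (fun n =>
         (complex.Re `|monomial n| `^ (n%:R^-1))%:E) <= 1)%E.

End BanachSpace.

(* Main.v *)
(* For (i), write [iota f = h * k] with [h] inner and [k] outer, so that
   [T f = psi * (h o phi) * (k o phi)] with [T f] outer. As [ln |T f|] and
   [ln |k|] are Poisson integrals of integrable functions, [- ln |psi|] is
   bounded on each circle [|z| = r < 1] by a constant plus a function whose mean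
   is small uniformly in [r]. Since [|psi|] tends to 1 radially almost everywhere,
   the circle means of [- ln |psi|] tend to 0; as [psi] has no zero, they are at
   least [- ln |psi 0|]. Hence [|psi 0| = 1] and [psi] is constant.

   For (ii), [psi] being constant, [phi] is injective. Take [z0] with
   [phi' z0 <> 0] and let [tau_a] be the involutive automorphism of the disk
   exchanging 0 and [a]. Then [S = (tau_(phi z0) o phi) / tau_z0] is holomorphic
   and has no zero. By injectivity [phi] stays away from [phi z0] near the
   circle, so [S] and [1 / S] are bounded; both have unimodular radial limits
   almost everywhere, whence [|S| = 1] on the disk and [S] is constant. *)
Require Import Defs.
From mathcomp Require Import all_boot all_order all_algebra.
From mathcomp Require Import all_classical all_reals all_analysis.
From mathcomp Require Import measurable_realfun complex ring lra.
Set Implicit Arguments.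
Unset Strict Implicit.
Unset Printing Implicit Defensive.

Import Order.TTheory GRing.Theory Num.Theory.
Import numFieldNormedType.Exports.

Local Open Scope classical_set_scope.
Local Open Scope ring_scope.
Local Open Scope complex_scope.

(** * Goursat's theorem for real vector fields *)

(** The complex analysis below rests on means of real parts over circles about 0. Goursat's
    bisection in polar coordinates shows that such a mean does not depend on the radius, and the
    Cauchy estimate follows from the mean value property. A difference quotient is continuous at its
    base point, but its differentiability there would require a removable singularity theorem;
    [holomorphic_off] therefore tolerates finitely many points of mere continuity, which the mean
    value property does not see.

    Two other detours shape (i). Jensen's inequality is reached without a holomorphic logarithm: an
    increment of the radius raises the circle mean of [ln |f|] by at most a multiple of its square,
    hence not at all. For an outer function, no boundary values are taken: the function under the
    Poisson integral is cut at a height, and Tonelli with the mean value property of the kernel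
    gives the circle means of the excess, the same for every radius. This uniformity is what allows
    bounded convergence to act on [- ln |psi|], itself cut at a fixed height. *)

Section SegmentIntegral.
Context {R : realType}.
Implicit Types (a b c : R) (f g : R -> R).

Definition segment_integral a b f : R :=
  \int[lebesgue_measure]_(x in `[a, b]) f x.

Definition continuous_between a b f :=
  forall x, a <= x <= b -> {for x, continuous f}.

Lemma continuous_between_integrable a b f : continuous_between a b f ->
  lebesgue_measure.-integrable `[a, b] (EFin \o f).
Proof.
move=> cf; apply: continuous_compact_integrable; first exact: segment_compact.
apply: continuous_in_subspaceT => x; rewrite inE/= in_itv/=; exact: cf.
Qed.

Lemma segment_integralB a b f g :
  continuous_between a b f -> continuous_between a b g ->
  segment_integral a b (fun x => f x - g x) =
  segment_integral a b f - segment_integral a b g.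
Proof.
by move=> cf cg; rewrite /segment_integral RintegralB//;
  exact: continuous_between_integrable.
Qed.

Lemma segment_integralD a b f g :
  continuous_between a b f -> continuous_between a b g ->
  segment_integral a b (fun x => f x + g x) =
  segment_integral a b f + segment_integral a b g.
Proof.
by move=> cf cg; rewrite /segment_integral RintegralD//;
  exact: continuous_between_integrable.
Qed.

Lemma segment_integralZ a b c f : continuous_between a b f ->
  segment_integral a b (fun x => c * f x) = c * segment_integral a b f.
Proof.
move=> cf; rewrite /segment_integral RintegralZl//.
exact: continuous_between_integrable.
Qed.

Lemma segment_integral_cst a b c : a <= b ->
  segment_integral a b (fun=> c) = c * (b - a).
Proof.
move=> ab; rewrite /segment_integral Rintegral_cst//= lebesgue_measure_itv/=.
rewrite lte_fin; have [_|] := ltP a b; first by rewrite -EFinB.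
by move=> ba; have -> : a = b; [apply/eqP; rewrite eq_le ab ba|rewrite subrr !mulr0].
Qed.

Lemma segment_integral_le a b f g :
  continuous_between a b f -> continuous_between a b g ->
  (forall x, a <= x <= b -> f x <= g x) ->
  segment_integral a b f <= segment_integral a b g.
Proof.
move=> cf cg fg; apply: le_Rintegral => //.
1,2: exact: continuous_between_integrable.
Qed.

Lemma continuous_between_cst a b c : continuous_between a b (fun=> c).
Proof. by move=> x _; exact: cvg_cst. Qed.

Lemma segment_integral_split a b c f : a <= b -> b <= c ->
  continuous_between a c f ->
  segment_integral a c f = segment_integral a b f + segment_integral b c f.
Proof.
move=> ab bc cf; have fi := continuous_between_integrable cf.
apply/eqP; rewrite addrC -subr_eq; apply/eqP; rewrite /segment_integral.
rewrite Rintegral_itvB// ?bnd_simp//.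
rewrite Rintegral_itv_obnd_cbnd//.
apply: integrableS fi => //; apply: subset_itvr.
by rewrite bnd_simp.
Qed.

Lemma segment_integral_near a b c M f : a <= b -> continuous_between a b f ->
  (forall x, a <= x <= b -> `|f x - c| <= M) ->
  `|segment_integral a b f - c * (b - a)| <= M * (b - a).
Proof.
move=> ab cf fM; rewrite ler_norml; apply/andP; split.
- rewrite lerBrDl -mulNr -mulrDl -segment_integral_cst//.
  apply: segment_integral_le => //; first exact: continuous_between_cst.
  by move=> x /fM; rewrite ler_norml; lra.
- rewrite lerBlDl -mulrDl -segment_integral_cst//.
  apply: segment_integral_le => //; first exact: continuous_between_cst.
  by move=> x /fM; rewrite ler_norml; lra.
Qed.

Lemma continuous_betweenB a b f g :
  continuous_between a b f -> continuous_between a b g ->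
  continuous_between a b (fun x => f x - g x).
Proof. by move=> cf cg x xab; apply: cvgB; [exact: cf|exact: cg]. Qed.

Lemma continuous_betweenW a b a' b' f : a <= a' -> b' <= b ->
  continuous_between a b f -> continuous_between a' b' f.
Proof. by move=> aa bb cf x /andP[ax xb]; apply: cf; lra. Qed.

End SegmentIntegral.

Section Goursat.
Context {R : realType}.
Implicit Types (U W : R -> R -> R) (a b s t : R).

Let dist_between (x y p q : R) : p <= x <= q -> p <= y <= q -> `|x - y| <= q - p.
Proof. by move=> /andP[px xq] /andP[py yq]; rewrite ler_norml !lerBlDr; lra. Qed.

(** Fréchet differentiability at [(s, t)], with partial derivatives [A] and [B], for the sum norm on
    the plane. *)
Definition differential_approx (U : R -> R -> R) s t A B := forall eta, 0 < eta ->
  exists2 d, 0 < d & forall s' t', `|s' - s| < d -> `|t' - t| < d ->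
    `|U s' t' - U s t - A * (s' - s) - B * (t' - t)| <=
      eta * (`|s' - s| + `|t' - t|).

(** The shared [A] equates the first partial derivative of [U] with the second of [W]: the field
    [(U, - W)] has divergence 0 at this point. Continuity of the derivatives is not assumed, which
    is why Goursat's argument is called for. *)
Definition divergence_free U W s t := exists A B D,
  differential_approx U s t A B /\ differential_approx W s t D A.

Lemma differential_approx_cvg U s t A B (u v : R -> R) x :
  differential_approx U s t A B -> u x = s -> v x = t ->
  {for x, continuous u} -> {for x, continuous v} ->
  {for x, continuous (fun y => U (u y) (v y))}.
Proof.
move=> UAB us vt cu cv; apply/cvgrPdist_le => e e0.
have [d d0 Ud] := UAB 1 ltr01.
pose M := 1 + `|A| + `|B|.
have M0 : 0 < M by rewrite /M; have := normr_ge0 A; have := normr_ge0 B; lra.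
have eM : 0 < Num.min d (e / (2 * M)).
  by rewrite lt_min d0 divr_gt0// mulr_gt0.
move/cvgrPdist_lt : (cu) => /(_ _ eM) Cu.
move/cvgrPdist_lt : (cv) => /(_ _ eM) Cv.
near=> y.
have : `|s - u y| < Num.min d (e / (2 * M)) by rewrite -us; near: y.
have : `|t - v y| < Num.min d (e / (2 * M)) by rewrite -vt; near: y.
rewrite !lt_min distrC (distrC s) => /andP[ty1 ty2] /andP[sy1 sy2].
have := Ud _ _ sy1 ty1; rewrite us vt distrC mul1r => Upq.
set p := u y - s in sy1 sy2 Upq; set q := v y - t in ty1 ty2 Upq.
have K : `|U s t - U (u y) (v y)| <= M * (`|p| + `|q|).
  have -> : U s t - U (u y) (v y) =
    (B * q - (U (u y) (v y) - U s t - A * p)) + (- (A * p)) + (- (B * q)) by lra.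
  rewrite (le_trans (ler_normD _ _))// (le_trans (lerD (ler_normD _ _) (lexx _)))//.
  rewrite !normrN !normrM /M.
  have : `|A| * `|q| >= 0 by rewrite mulr_ge0.
  have : `|B| * `|p| >= 0 by rewrite mulr_ge0.
  by lra.
apply: (le_trans K); rewrite ltW//.
rewrite -ltr_pdivlMl//.
have -> : M^-1 * e = e / (2 * M) + e / (2 * M) by field; rewrite gt_eqF.
exact: ltrD.
Unshelve. all: by end_near. Qed.

Variables (U W : R -> R -> R) (a b c d : R).
Hypotheses (ab : a <= b) (cd : c <= d).
Hypothesis dUW : forall s t, a <= s <= b -> c <= t <= d ->
  divergence_free U W s t.

Let contU s : a <= s <= b -> continuous_between c d (U s).
Proof.
move=> sab x xcd; have [A [B [D [UAB _]]]] := dUW sab xcd.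
apply: (@differential_approx_cvg U s x A B (fun=> s) id) => //; exact: cvg_cst.
Qed.

Let contW t : c <= t <= d -> continuous_between a b (W^~ t).
Proof.
move=> tcd x xab; have [A [B [D [_ WAB]]]] := dUW xab tcd.
apply: (@differential_approx_cvg W x t D A id (fun=> t)) => //; exact: cvg_cst.
Qed.

(** Outward flux of [(U, - W)] through the boundary of a rectangle. *)
Let flux a b c d :=
  (segment_integral c d (U b) - segment_integral c d (U a)) -
  (segment_integral a b (W^~ d) - segment_integral a b (W^~ c)).

Let flux_split a' b' c' d' m n : a <= a' -> a' <= m -> m <= b' -> b' <= b ->
  c <= c' -> c' <= n -> n <= d' -> d' <= d ->
  flux a' b' c' d' = flux a' m c' n + flux a' m n d' +
                     flux m b' c' n + flux m b' n d'.
Proof.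
move=> aa am mb bb cc cn nd dd; rewrite /flux.
rewrite (@segment_integral_split _ c' n d' (U b'))//; last first.
  by apply: continuous_betweenW (contU _); lra.
rewrite (@segment_integral_split _ c' n d' (U a'))//; last first.
  by apply: continuous_betweenW (contU _); lra.
rewrite (@segment_integral_split _ a' m b' (W^~ d'))//; last first.
  by apply: continuous_betweenW (contW _); lra.
rewrite (@segment_integral_split _ a' m b' (W^~ c'))//; last first.
  by apply: continuous_betweenW (contW _); lra.
by lra.
Qed.

(** On a rectangle of sides [w] and [h] around the point, the affine part contributes [A * w * h]
    through the vertical sides and the same through the horizontal ones, so it cancels because [A]
    is shared. The remainders are at most [eta * (w + h)] times [h], respectively [w]. *)
Let flux_small s t : a <= s <= b -> c <= t <= d -> forall eta, 0 < eta ->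
  exists2 e, 0 < e & forall a' b' c' d',
    a <= a' -> a' <= s -> s <= b' -> b' <= b ->
    c <= c' -> c' <= t -> t <= d' -> d' <= d ->
    b' - a' < e -> d' - c' < e ->
    `|flux a' b' c' d'| <= eta * (b' - a' + (d' - c')) ^+ 2.
Proof.
move=> sab tcd eta eta0; have [A [B [D [UAB WDA]]]] := dUW sab tcd.
have eta2 : 0 < eta / 2 by rewrite divr_gt0.
have [e1 e10 U1] := UAB _ eta2; have [e2 e20 W1] := WDA _ eta2.
exists (Num.min e1 e2); first by rewrite lt_min e10.
move=> a' b' c' d' aa as' sb bb cc ct td dd; rewrite !lt_min.
move=> /andP[w1 w2] /andP[h1 h2]; rewrite /flux.
have aa' : a <= a' <= b by rewrite aa (le_trans as' (le_trans sb bb)).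
have bb' : a <= b' <= b by rewrite bb (le_trans aa (le_trans as' sb)).
have cc' : c <= c' <= d by rewrite cc (le_trans ct (le_trans td dd)).
have dd' : c <= d' <= d by rewrite dd (le_trans cc (le_trans ct td)).
have ca' := continuous_betweenW cc dd (contU aa').
have cb' := continuous_betweenW cc dd (contU bb').
have cW := continuous_betweenW aa bb (contW cc').
have cW' := continuous_betweenW aa bb (contW dd').
rewrite -segment_integralB// -segment_integralB//.
set w := b' - a'; set h := d' - c'.
have ab' := le_trans as' sb; have cd' := le_trans ct td.
have K1 : forall x, c' <= x <= d' ->
    `|U b' x - U a' x - A * w| <= eta * (w + h).
  move=> x /andP[x1 x2].
  have xh : `|x - t| <= h by apply: dist_between; rewrite ?x1 ?ct.
  have bw : `|b' - s| <= w by apply: dist_between; rewrite ?ab' ?as' ?lexx.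
  have aw : `|a' - s| <= w by apply: dist_between; rewrite ?ab' ?as' ?lexx.
  have := U1 b' x (le_lt_trans bw w1) (le_lt_trans xh h1).
  have := U1 a' x (le_lt_trans aw w1) (le_lt_trans xh h1).
  set p := _ * (`|_| + `|_|) => P1; set q := _ * (`|_| + `|_|) => P2.
  have : p <= eta / 2 * (w + h) by rewrite ler_pM2l// lerD.
  have : q <= eta / 2 * (w + h) by rewrite ler_pM2l// lerD.
  move: P1 P2; rewrite !ler_norml /w => *; lra.
have K2 : forall x, a' <= x <= b' ->
    `|W x d' - W x c' - A * h| <= eta * (w + h).
  move=> x /andP[x1 x2].
  have xh : `|x - s| <= w by apply: dist_between; rewrite ?x1 ?as'.
  have bw : `|d' - t| <= h by apply: dist_between; rewrite ?cd' ?ct ?lexx.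
  have aw : `|c' - t| <= h by apply: dist_between; rewrite ?cd' ?ct ?lexx.
  have := W1 x d' (le_lt_trans xh w2) (le_lt_trans bw h2).
  have := W1 x c' (le_lt_trans xh w2) (le_lt_trans aw h2).
  set p := _ * (`|_| + `|_|) => P1; set q := _ * (`|_| + `|_|) => P2.
  have : p <= eta / 2 * (w + h) by rewrite ler_pM2l// lerD.
  have : q <= eta / 2 * (w + h) by rewrite ler_pM2l// lerD.
  move: P1 P2; rewrite !ler_norml /h => *; lra.
have H1 := segment_integral_near cd' (continuous_betweenB cb' ca') K1.
have H2 := segment_integral_near ab' (continuous_betweenB cW' cW) K2.
move: H1 H2; rewrite -/w -/h !ler_norml !expr2 => *; lra.
Qed.

(** Goursat's bisection. A nonzero flux [e] survives, up to the factor [4 ^ n], in one rectangle of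
    each stage of a repeated quartering; at the common point of these rectangles [flux_small] gives
    a bound that is smaller by a factor 2. *)
Theorem goursat :
  segment_integral c d (U b) - segment_integral c d (U a) =
  segment_integral a b (W^~ d) - segment_integral a b (W^~ c).
Proof.
apply/eqP; rewrite -subr_eq0 -[X in X == _]/(flux a b c d).
apply: contraT => fl0.
pose w n := (b - a) / 2 ^+ n; pose h n := (d - c) / 2 ^+ n.
pose e := `|flux a b c d|; have e0 : 0 < e by rewrite normr_gt0.
have wS n : w n = w n.+1 + w n.+1.
  by rewrite /w exprS; field; rewrite expf_neq0.
have hS n : h n = h n.+1 + h n.+1.
  by rewrite /h exprS; field; rewrite expf_neq0.
have w_ge0 n : 0 <= w n by rewrite divr_ge0// ?subr_ge0// exprn_ge0.
have h_ge0 n : 0 <= h n by rewrite divr_ge0// ?subr_ge0// exprn_ge0.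
pose bad n (p : R * R) := [/\ a <= p.1, p.1 + w n <= b, c <= p.2,
  p.2 + h n <= d & e / 4 ^+ n <= `|flux p.1 (p.1 + w n) p.2 (p.2 + h n)|].
pose nxt n (p q : R * R) := [/\ p.1 <= q.1, q.1 + w n.+1 <= p.1 + w n,
  p.2 <= q.2, q.2 + h n.+1 <= p.2 + h n & bad n.+1 q].
(* The stage is paired with the lower left corner, so that [choice] yields a single function; on a
   corner that is not bad the value is a dummy. *)
have step (np : nat * (R * R)) : exists q, bad np.1 np.2 -> nxt np.1 np.2 q.
  case: np => n [x y] /=.
  have [bd|] := pselect (bad n (x, y)); last by exists (0, 0).
  case: (bd) => /= x1 x2 y1 y2 F.
  pose good i j := e / 4 ^+ n.+1 <= `|flux (x + i) (x + i + w n.+1) (y + j)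
     (y + j + h n.+1)|.
  suff [i [j [ii jj ij]]] : exists i j, [/\ 0 <= i <= w n.+1, 0 <= j <= h n.+1
      & good i j].
    exists (x + i, y + j) => _; have := wS n; have := hS n.
    by split; rewrite /=; last split => //=; lra.
  have Fs : flux x (x + w n) y (y + h n) =
      flux (x + 0) (x + 0 + w n.+1) (y + 0) (y + 0 + h n.+1) +
      flux (x + 0) (x + 0 + w n.+1) (y + h n.+1) (y + h n.+1 + h n.+1) +
      flux (x + w n.+1) (x + w n.+1 + w n.+1) (y + 0) (y + 0 + h n.+1) +
      flux (x + w n.+1) (x + w n.+1 + w n.+1)
        (y + h n.+1) (y + h n.+1 + h n.+1).
    have := w_ge0 n.+1; have := h_ge0 n.+1; have := wS n; have := hS n => *.
    have E1 : x + w n = x + w n.+1 + w n.+1 by lra.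
    have E2 : y + h n = y + h n.+1 + h n.+1 by lra.
    by rewrite !addr0 E1 E2; apply: flux_split; lra.
  have e4 : e / 4 ^+ n = 4 * (e / 4 ^+ n.+1).
    by rewrite exprS; field; rewrite expf_neq0.
  have w0' := w_ge0 n.+1; have h0' := h_ge0 n.+1.
  have [g00|] := pselect (good 0 0).
    by exists 0, 0; split; rewrite ?lexx.
  have [g01|] := pselect (good 0 (h n.+1)).
    by exists 0, (h n.+1); split; rewrite ?lexx ?andbT.
  have [g10|] := pselect (good (w n.+1) 0).
    by exists (w n.+1), 0; split; rewrite ?lexx ?andbT.
  have [g11|] := pselect (good (w n.+1) (h n.+1)).
    by exists (w n.+1), (h n.+1); split; rewrite ?lexx ?andbT.
  rewrite /good => /negP; rewrite -ltNge => g1 /negP; rewrite -ltNge => g2.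
  move=> /negP; rewrite -ltNge => g3 /negP; rewrite -ltNge => g4.
  exfalso; move: F; rewrite e4 Fs leNgt => /negP; apply.
  rewrite (le_lt_trans (ler_normD _ _))//.
  rewrite (le_lt_trans (lerD (ler_normD _ _) (lexx _)))//.
  rewrite (le_lt_trans (lerD (lerD (ler_normD _ _) (lexx _)) (lexx _)))//.
  by lra.
have [f fP] := choice step.
pose P := fix P n := if n is m.+1 then f (m, P m) else (a, c).
have w00 : w 0%N = b - a by rewrite /w expr0 divr1.
have h00 : h 0%N = d - c by rewrite /h expr0 divr1.
have bP n : bad n (P n).
  elim: n => [|n IH] /=; last by have [] := fP (n, P n) IH.
  rewrite /bad /= w00 h00 expr0 divr1 !subrKC; split=> //; lra.
have nP n : nxt n (P n) (P n.+1) by exact: (fP (n, P n) (bP n)).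
have mon n k : [/\ (P n).1 <= (P (n + k)%N).1,
    (P (n + k)%N).1 + w (n + k)%N <= (P n).1 + w n,
    (P n).2 <= (P (n + k)%N).2 &
    (P (n + k)%N).2 + h (n + k)%N <= (P n).2 + h n].
  elim: k => [|k [IH1 IH2 IH3 IH4]]; first by rewrite addn0.
  by rewrite addnS; have [? ? ? ? _] := nP (n + k)%N; split; lra.
pose x := sup [set (P n).1 | n in setT]; pose y := sup [set (P n).2 | n in setT].
have xP n : (P n).1 <= x <= (P n).1 + w n.
  apply/andP; split.
    apply: ub_le_sup; last by exists n.
    by exists b => _ [m _ <-]; case: (bP m); have := w_ge0 m; lra.
  apply: ge_sup; first by exists (P 0%N).1, 0%N.
  move=> _ [m _ <-]; have [nm|/ltnW mn] := leqP n m.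
    by have [_ + _ _] := mon n (m - n)%N; rewrite subnKC//; have := w_ge0 m; lra.
  by have [+ _ _ _] := mon m (n - m)%N; rewrite subnKC//; have := w_ge0 n; lra.
have yP n : (P n).2 <= y <= (P n).2 + h n.
  apply/andP; split.
    apply: ub_le_sup; last by exists n.
    by exists d => _ [m _ <-]; case: (bP m); have := h_ge0 m; lra.
  apply: ge_sup; first by exists (P 0%N).2, 0%N.
  move=> _ [m _ <-]; have [nm|/ltnW mn] := leqP n m.
    by have [_ _ _ +] := mon n (m - n)%N; rewrite subnKC//; have := h_ge0 m; lra.
  by have [_ _ + _] := mon m (n - m)%N; rewrite subnKC//; have := h_ge0 n; lra.
have xab : a <= x <= b by have := xP 0%N; rewrite w00 /=; lra.
have ycd : c <= y <= d by have := yP 0%N; rewrite h00 /=; lra.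
(* The term 1 keeps [L] positive for a degenerate rectangle. As stage [n] has half perimeter at most
   [L / 2 ^ n], the choice [e / (2 * L ^ 2)] for [eta] bounds its flux by half of [e / 4 ^ n]. *)
pose L := (b - a) + (d - c) + 1.
have L0 : 0 < L by rewrite /L; lra.
have eta0 : 0 < e / (2 * L ^+ 2) by rewrite divr_gt0// mulr_gt0// exprn_gt0.
have [r r0 rP] := @flux_small x y xab ycd _ eta0.
have [n Ln] : exists n, L / 2 ^+ n < r.
  have : (fun n => L * 2^-1 ^+ n) @ \oo --> (0 : R).
    rewrite -(mulr0 L); apply: cvgM; first exact: cvg_cst.
    by apply: cvg_expr; rewrite ger0_norm//; lra.
  move/cvgrPdist_lt => /(_ r r0)[n _ /(_ n (leqnn n))].
  rewrite sub0r normrN ger0_norm ?exprVn => [?|]; first by exists n.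
  by rewrite mulr_ge0 ?invr_ge0 ?exprn_ge0// ltW.
have wL : w n + h n <= L / 2 ^+ n.
  rewrite /w /h /L -mulrDl ler_pM2r ?invr_gt0 ?exprn_gt0//; lra.
have [a1 a2 c1 c2 Fn] := bP n.
move: (xP n) (yP n) => /andP[x1 x2] /andP[y1 y2].
have wh := conj (w_ge0 n) (h_ge0 n).
have := rP _ _ _ _ a1 x1 x2 a2 c1 y1 y2 c2 ltac:(lra) ltac:(lra).
suff : e / (2 * L ^+ 2) * ((P n).1 + w n - (P n).1 + ((P n).2 + h n - (P n).2)) ^+ 2
    < e / 4 ^+ n by lra.
have -> : (P n).1 + w n - (P n).1 + ((P n).2 + h n - (P n).2) = w n + h n by lra.
have : (w n + h n) ^+ 2 <= (L / 2 ^+ n) ^+ 2.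
  by rewrite ler_pXn2r ?nnegrE//; [lra|rewrite divr_ge0 ?exprn_ge0// ltW].
move=> K; apply: (@le_lt_trans _ _ (e / (2 * L ^+ 2) * (L / 2 ^+ n) ^+ 2)).
  by rewrite ler_pM2l.
have -> : e / (2 * L ^+ 2) * (L / 2 ^+ n) ^+ 2 = e / 4 ^+ n / 2.
  rewrite expr_div_n -exprM mulnC exprM.
  have -> : (2 : R) ^+ 2 = 4 by rewrite expr2; lra.
  by field; rewrite expf_neq0//= gt_eqF.
have : 0 < e / 4 ^+ n by rewrite divr_gt0 ?exprn_gt0.
lra.
Qed.

End Goursat.

(** * Complex differentiability in terms of moduli *)

Lemma derivable_expansion (K : numFieldType) (f : K -> K) (x : K) :
  derivable f x 1 -> forall e : K, 0 < e ->
  \forall y \near x, `|f y - f x - 'D_1 f x * (y - x)| <= e * `|y - x|.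
Proof.
move=> df e e0.
have /cvgrPdist_le/(_ e e0) : h^-1 *: ((f \o shift x) (h *: 1) - f x) @[h --> 0^'] --> 'D_1 f x.
  exact: df.
rewrite near_withinE => /nbhs_ballP[d d0 D]; apply/nbhs_ballP.
exists d => // y xy /=.
have [->|yx] := eqVneq y x; first by rewrite !subrr mulr0 subrr normr0 mulr0.
have yx0 : y - x != 0 by rewrite subr_eq0.
have xy' : ball (0 : K) d (y - x).
  by move: xy; rewrite -!ball_normE/= sub0r normrN distrC.
have := D (y - x) xy' yx0 => /=; rewrite /shift.
rewrite scaler1 subrK [_ *: _]mulrC => H.
have -> : f y - f x - 'D_1 f x * (y - x) =
  - (('D_1 f x - (f y - f x) / (y - x)) * (y - x)).
  by rewrite mulrBl divfK// opprB.
by rewrite normrN normrM ler_wpM2r.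
Qed.

Lemma derivable_comp_num (K : numFieldType) (f g : K -> K) (x : K) :
  derivable f x 1 -> derivable g (f x) 1 -> derivable (g \o f) x 1.
Proof.
move=> /derivable1_diffP df /derivable1_diffP dg.
exact/derivable1_diffP/differentiable_comp.
Qed.

Section Modulus.
Context {R : realType}.
Implicit Types (z w : R[i]) (r s t : R).

(** The norm of [R[i]] has complex values; a real one gives access to real integrals, logarithms and
    [lra]. *)
Definition modulus z : R := complex.Re `|z|.

Lemma normcE z : `|z| = (modulus z)%:C.
Proof. by rewrite /modulus RRe_real// normr_real. Qed.

Lemma modulus_ge0 z : 0 <= modulus z.
Proof. by rewrite -lecR -normcE; exact: normr_ge0. Qed.

Lemma modulusM z w : modulus (z * w) = modulus z * modulus w.
Proof. by apply: complexI; rewrite rmorphM -!normcE normrM. Qed.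

Lemma modulusD z w : modulus (z + w) <= modulus z + modulus w.
Proof. by rewrite -lecR rmorphD -!normcE ler_normD. Qed.

Lemma modulusN z : modulus (- z) = modulus z.
Proof. by rewrite /modulus normrN. Qed.

Lemma modulusV z : modulus z^-1 = (modulus z)^-1.
Proof. by apply: complexI; rewrite fmorphV -!normcE normfV. Qed.

Lemma modulusX z n : modulus (z ^+ n) = modulus z ^+ n.
Proof. by apply: complexI; rewrite rmorphXn -!normcE normrX. Qed.

Lemma modulus0 : modulus 0 = 0. Proof. by rewrite /modulus normr0. Qed.

Lemma modulus1 : modulus 1 = 1. Proof. by rewrite /modulus normr1. Qed.

Lemma modulusB z w : modulus (z - w) = modulus (w - z).
Proof. by rewrite -modulusN opprB. Qed.

Lemma modulus_eq0 z : (modulus z == 0) = (z == 0).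
Proof. by rewrite -(inj_eq (@complexI _)) -normcE normr_eq0. Qed.

Lemma modulus_gt0 z : (0 < modulus z) = (z != 0).
Proof. by rewrite lt_neqAle modulus_ge0 andbT eq_sym modulus_eq0. Qed.

Lemma modulusC r : modulus r%:C = `|r|.
Proof. by rewrite /modulus normc_def /= expr0n/= addr0 sqrtr_sqr. Qed.

Lemma modulus_sqr z : modulus z ^+ 2 = complex.Re z ^+ 2 + complex.Im z ^+ 2.
Proof.
by apply: complexI; rewrite add_Re2_Im2 normcE -rmorphXn.
Qed.

Lemma ler_Re_modulus z : `|complex.Re z| <= modulus z.
Proof. by rewrite -lecR -normcE normc_ge_Re. Qed.

Lemma ler_Im_modulus z : `|complex.Im z| <= modulus z.
Proof.
rewrite -(@ler_pXn2r _ 2)// ?nnegrE ?modulus_ge0// modulus_sqr.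
by rewrite real_normK ?num_real// lerDr sqr_ge0.
Qed.

Lemma modulus_le_ReIm z : modulus z <= `|complex.Re z| + `|complex.Im z|.
Proof.
rewrite -(@ler_pXn2r _ 2)// ?nnegrE ?modulus_ge0 ?addr_ge0// modulus_sqr.
by rewrite sqrrD !real_normK ?num_real// -addrA lerD2l lerDr mulrn_wge0.
Qed.

Lemma modulus_cis t : modulus (cis t) = 1.
Proof.
apply/eqP; rewrite -(@eqrXn2 _ 2)// ?modulus_ge0// modulus_sqr /= expr1n.
by rewrite cos2Dsin2.
Qed.

Lemma diskE z : disk z = (modulus z < 1) :> Prop.
Proof. by rewrite /disk/= normcE -[1]/((1 : R)%:C) ltcR. Qed.

Lemma modulusJ z : modulus (conjc z) = modulus z.
Proof. by rewrite /modulus normcJ. Qed.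

Lemma RemulC r z : complex.Re (r%:C * z) = r * complex.Re z.
Proof. by case: z => x y /=; rewrite mul0r subr0. Qed.

Lemma polar z : exists t, 0 <= t <= 2 * pi /\ z = (modulus z)%:C * cis t.
Proof.
have [->|z0] := eqVneq z 0.
  by exists 0; rewrite modulus0 mul0r mulr_ge0 ?pi_ge0// lexx.
have m0 : 0 < modulus z by rewrite modulus_gt0.
set m := modulus z in m0 *; pose x := complex.Re z / m; pose y := complex.Im z / m.
have xy1 : x ^+ 2 + y ^+ 2 = 1.
  by rewrite /x /y !expr_div_n -mulrDl -modulus_sqr divff// expf_neq0// gt_eqF.
have x1 : -1 <= x <= 1.
  rewrite -ler_norml -(@expr_le1 _ 2)// real_normK ?num_real//.
  by have := sqr_ge0 y; lra.
have [ac cac] := acos_def x1; have p0 := pi_ge0 R.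
have mz : z = m%:C * (x +i* y).
  apply/eqP; rewrite eq_complex /= !mul0r subr0 addr0 /x /y.
  have mn : m != 0 by rewrite gt_eqF.
  by rewrite ![m * _]mulrC !divfK// !eqxx.
have ys : y ^+ 2 = sin (acos x) ^+ 2.
  by have := cos2Dsin2 (acos x); rewrite cac; lra.
have /orP[/eqP yE|/eqP yE] : (y == sin (acos x)) || (y == - sin (acos x)).
- by rewrite -eqf_sqr ys.
- by exists (acos x); split; [lra|rewrite [LHS]mz /cis cac yE].
- exists (2 * pi - acos x); split; first lra.
  have -> : 2 * pi - acos x = - acos x + pi *+ 2 by rewrite mulr_natl addrC.
  by rewrite [LHS]mz /cis cosD2pi sinD2pi cosN sinN cac yE.
Qed.

End Modulus.

Section ComplexTopology.
Context {R : realType}.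

Lemma ccvgrP T (F : set_system T) (FF : Filter F) (f : T -> R[i]^o) (l : R[i]^o) :
  f @ F --> l <-> forall e : R, 0 < e -> \forall x \near F, modulus (l - f x) < e.
Proof.
split=> [/cvgrPdist_lt fl e e0|fl].
  have e0C : 0 < (e%:C : R[i]) by rewrite ltcR.
  by have := fl _ e0C; apply: filterS => x; rewrite normcE ltcR.
apply/cvgrPdist_lt => e e0.
have eE : e = (complex.Re e)%:C by rewrite RRe_real// gtr0_real.
have e0R : 0 < complex.Re e by rewrite -ltcR -eE.
by have := fl _ e0R; apply: filterS => x; rewrite normcE eE ltcR.
Qed.

Lemma near_cplx (z : R[i]^o) (P : R[i]^o -> Prop) :
  (\forall w \near z, P w) <->
  exists2 d : R, 0 < d & forall w, modulus (w - z) < d -> P w.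
Proof.
split=> [/nbhs_ballP[e e0 D]|[d d0 D]].
  have eE : e = (complex.Re e)%:C by rewrite RRe_real// gtr0_real.
  exists (complex.Re e); first by rewrite -ltcR -eE.
  by move=> w wz; apply: D; rewrite /ball/= distrC normcE eE ltcR.
apply/nbhs_ballP; exists d%:C; first by rewrite /= ltcR.
by move=> w; rewrite /ball/= distrC normcE ltcR; exact: D.
Qed.

Lemma cvg_modulus T (F : set_system T) (FF : Filter F) (f : T -> R[i]^o) (l : R[i]^o) :
  f @ F --> l -> (fun x => modulus (f x)) @ F --> modulus l.
Proof.
move=> /ccvgrP fl; apply/cvgrPdist_lt => e e0; have := fl _ e0.
apply: filterS => x; apply: le_lt_trans; rewrite ler_norml.
have := modulusD (l - f x) (f x); have := modulusD (f x - l) l.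
rewrite !subrK (modulusB (f x)); lra.
Qed.

Lemma cvg_Re T (F : set_system T) (FF : Filter F) (f : T -> R[i]^o) (l : R[i]^o) :
  f @ F --> l -> (fun x => complex.Re (f x)) @ F --> complex.Re l.
Proof.
move=> /ccvgrP fl; apply/cvgrPdist_lt => e e0; have := fl _ e0.
apply: filterS => x; apply: le_lt_trans; rewrite (le_trans _ (ler_Re_modulus _))//.
by rewrite raddfB.
Qed.

Lemma cvg_complex T (F : set_system T) (FF : Filter F) (u v : T -> R) (x y : R) :
  u @ F --> x -> v @ F --> y -> (fun t => u t +i* v t : R[i]^o) @ F --> (x +i* y : R[i]^o).
Proof.
move=> /cvgrPdist_lt ux /cvgrPdist_lt vy; apply/ccvgrP => e e0.
have e2 : 0 < e / 2 by rewrite divr_gt0.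
apply: filterS2 (ux _ e2) (vy _ e2) => t ut vt.
rewrite (le_lt_trans (modulus_le_ReIm _))//=; lra.
Qed.

Lemma derivable_expansionC (f : R[i]^o -> R[i]^o) (z : R[i]^o) :
  derivable f z 1 -> exists l : R[i], forall e : R, 0 < e ->
  exists2 d : R, 0 < d & forall w, modulus (w - z) < d ->
    modulus (f w - f z - l * (w - z)) <= e * modulus (w - z).
Proof.
move=> df; exists ('D_1 f z) => e e0.
have e0C : 0 < (e%:C : R[i]) by rewrite ltcR.
have := @derivable_expansion R[i] f z df _ e0C => /near_cplx[d d0 D].
by exists d => // w /D; rewrite !normcE -rmorphM lecR.
Qed.

Lemma derivable_continuousC (f : R[i]^o -> R[i]^o) (z : R[i]^o) :
  derivable f z 1 -> {for z, continuous f}.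
Proof. by move=> /(@derivable1_diffP _ _ f) /differentiable_continuous. Qed.

Lemma derivable_compC (f g : R[i]^o -> R[i]^o) (z : R[i]^o) :
  derivable f z 1 -> derivable g (f z) 1 -> derivable (g \o f) z 1.
Proof.
exact: (@derivable_comp_num R[i]).
Qed.

End ComplexTopology.

(** * Mean value property *)

Section DifferentialApprox.
Context {R : realType}.
Implicit Types (F X Y : R -> R -> R) (s t A B : R).

Let linear_bound (x A B p q e : R) : 
  `|x - A * p - B * q| <= e * (`|p| + `|q|) ->
  `|x| <= (e + `|A| + `|B|) * (`|p| + `|q|).
Proof.
move=> H.
have -> : x = (x - A * p - B * q) + A * p + B * q by lra.
rewrite (le_trans (ler_normD _ _))// (le_trans (lerD (ler_normD _ _) (lexx _)))//.
rewrite !normrM.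
have : `|A| * `|q| >= 0 by rewrite mulr_ge0.
have : `|B| * `|p| >= 0 by rewrite mulr_ge0.
by lra.
Qed.

Lemma differential_approx_comp F X Y s t P Q A B A' B' :
  differential_approx F (X s t) (Y s t) P Q ->
  differential_approx X s t A B -> differential_approx Y s t A' B' ->
  differential_approx (fun s t => F (X s t) (Y s t)) s t
    (P * A + Q * A') (P * B + Q * B').
Proof.
move=> FF XX YY eta eta0.
have [nA nB nA' nB'] := And4 (normr_ge0 A) (normr_ge0 B) (normr_ge0 A') (normr_ge0 B').
have [nP nQ] := conj (normr_ge0 P) (normr_ge0 Q).
pose K := 1 + `|A| + `|B| + `|A'| + `|B'|.
have K0 : 0 < K by rewrite /K; lra.
have e10 : 0 < eta / (4 * K) by rewrite divr_gt0// mulr_gt0.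
have PQ0 : 0 < 1 + `|P| + `|Q| by lra.
(* The cap 1 bounds the increments of [X] and [Y] by [K * N]; the other term makes their errors,
   weighted by [P] and [Q], at most [eta / 4 * N] together. The outer error takes [eta / 2 * N]. *)
pose e2 := Num.min 1 (eta / (4 * (1 + `|P| + `|Q|))).
have e20 : 0 < e2 by rewrite lt_min ltr01 divr_gt0// mulr_gt0.
have e21 : e2 <= 1 by rewrite ge_min lexx.
have e2PQ : e2 * (`|P| + `|Q|) <= eta / 4.
  apply: (@le_trans _ _ (eta / (4 * (1 + `|P| + `|Q|)) * (1 + `|P| + `|Q|))).
    apply: ler_pM; [exact: ltW|exact: addr_ge0|by rewrite ge_min lexx orbT|].
    by rewrite -addrA lerDr.
  by rewrite invfM mulrA mulfVK ?gt_eqF.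
have [d1 d10 F1] := FF _ e10; have [dX dX0 X1] := XX _ e20.
have [dY dY0 Y1] := YY _ e20.
pose d := Num.min (Num.min dX dY) (d1 / (2 * K)).
exists d; first by rewrite !lt_min dX0 dY0 divr_gt0// mulr_gt0.
move=> s' t'; rewrite !lt_min => /andP[/andP[sX sY] sF] /andP[/andP[tX tY] tF].
have := X1 _ _ sX tX; have := Y1 _ _ sY tY.
set p := s' - s in sF *; set q := t' - t in tF *.
set N := `|p| + `|q|.
have N0 : 0 <= N by rewrite addr_ge0.
have NF : K * N < d1.
  have -> : d1 = K * (d1 / (2 * K) + d1 / (2 * K)) by field; rewrite gt_eqF.
  by rewrite ltr_pM2l// ltrD.
set x := X s' t' - X s t; set y := Y s' t' - Y s t => YE XE.
have xK : `|x| <= K * N.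
  apply: (le_trans (linear_bound XE)); apply: ler_wpM2r => //.
  by move: e21; rewrite /K; clear -nA' nB'; lra.
have yK : `|y| <= K * N.
  apply: (le_trans (linear_bound YE)); apply: ler_wpM2r => //.
  by move: e21; rewrite /K; clear -nA nB; lra.
have := F1 (X s' t') (Y s' t') (le_lt_trans xK NF) (le_lt_trans yK NF).
rewrite -/x -/y; set u := F _ _ - F _ _ => FE.
have -> : u - (P * A + Q * A') * p - (P * B + Q * B') * q =
  (u - P * x - Q * y) + P * (x - A * p - B * q) + Q * (y - A' * p - B' * q).
  by clear; lra.
rewrite (le_trans (ler_normD _ _))// (le_trans (lerD (ler_normD _ _) (lexx _)))//.
rewrite !normrM.
have H1 : eta / (4 * K) * (`|x| + `|y|) <= eta / 2 * N.
  have -> : eta / 2 * N = eta / (4 * K) * (K * N + K * N).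
    by field; rewrite gt_eqF.
  by rewrite ler_pM2l// lerD.
have H2 : `|P| * `|x - A * p - B * q| <= `|P| * (e2 * N) by rewrite ler_wpM2l.
have H3 : `|Q| * `|y - A' * p - B' * q| <= `|Q| * (e2 * N) by rewrite ler_wpM2l.
have H4 : e2 * (`|P| + `|Q|) * N <= eta / 4 * N by rewrite ler_wpM2r.
have H5 : 0 <= eta * N by rewrite mulr_ge0// ltW.
by move: FE H1 H2 H3 H4 H5; clear; lra.
Qed.

Lemma differential_approx_mul (x y : R) :
  differential_approx (fun x y => x * y) x y y x.
Proof.
move=> eta eta0; exists eta => // x' y' xx' yy'.
have -> : x' * y' - x * y - y * (x' - x) - x * (y' - y) = (x' - x) * (y' - y).
  by ring.
rewrite normrM (le_trans (ler_wpM2r (normr_ge0 _) (ltW xx')))// ler_pM2l//.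
by rewrite lerDr.
Qed.

Let derivable_approx (g : R -> R) x l : is_derive (x : R^o) 1 g l -> forall eta, 0 < eta ->
  exists2 d, 0 < d & forall y, `|y - x| < d ->
    `|g y - g x - l * (y - x)| <= eta * `|y - x|.
Proof.
move=> dg eta eta0; have dg1 : derivable g x 1 by exact: ex_derive.
have /nbhs_ballP[d d0 D] := derivable_expansion dg1 eta0.
exists d => // y yx; have := D y; rewrite -ball_normE/= distrC => /(_ yx).
by rewrite derive_val.
Qed.

Lemma differential_approx_fst (g : R -> R) s t l : is_derive (s : R^o) 1 g l ->
  differential_approx (fun s _ => g s) s t l 0.
Proof.
move=> /derivable_approx D eta eta0; have [d d0 {}D] := D _ eta0.
exists d => // s' t' ss' _; rewrite mul0r subr0 (le_trans (D _ ss'))//.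
by rewrite ler_pM2l// lerDl.
Qed.

Lemma differential_approx_snd (g : R -> R) s t l : is_derive (t : R^o) 1 g l ->
  differential_approx (fun _ t => g t) s t 0 l.
Proof.
move=> /derivable_approx D eta eta0; have [d d0 {}D] := D _ eta0.
exists d => // s' t' _ tt'; rewrite mul0r subr0 (le_trans (D _ tt'))//.
by rewrite ler_pM2l// lerDr.
Qed.

Lemma differential_approxM F X s t A B A' B' :
  differential_approx F s t A B -> differential_approx X s t A' B' ->
  differential_approx (fun s t => F s t * X s t) s t
    (X s t * A + F s t * A') (X s t * B + F s t * B').
Proof.
move=> FF XX.
exact: (differential_approx_comp (differential_approx_mul _ _) FF XX).
Qed.

Lemma cauchy_riemann (f : R[i]^o -> R[i]^o) x y : derivable f (x +i* y) 1 ->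
  exists p q,
    differential_approx (fun x y => complex.Re (f (x +i* y))) x y p (- q) /\
    differential_approx (fun x y => complex.Im (f (x +i* y))) x y q p.
Proof.
move=> /derivable_expansionC[l D]; exists (complex.Re l), (complex.Im l).
have E eta : 0 < eta -> exists2 d, 0 < d & forall x' y',
    `|x' - x| < d -> `|y' - y| < d ->
    modulus (f (x' +i* y') - f (x +i* y) - l * ((x' - x) +i* (y' - y))) <=
    eta * (`|x' - x| + `|y' - y|).
  move=> eta0; have [d d0 {}D] := D _ eta0.
  exists (d / 2); first by rewrite divr_gt0.
  move=> x' y' xx yy.
  have K := modulus_le_ReIm ((x' - x) +i* (y' - y)).
  have := D (x' +i* y'); rewrite [_ +i* _ - _]/= => H.
  rewrite (le_trans (H _))//; first by rewrite (le_lt_trans K)//=; lra.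
  by rewrite ler_pM2l.
split=> eta eta0; have [d d0 {}D] := E _ eta0; exists d => // x' y' xx yy.
- apply: le_trans (D _ _ xx yy); apply: le_trans (ler_Re_modulus _).
  rewrite !raddfB /= mulNr opprK.
  case: l {E D} => p q; rewrite /= [X in _ <= `|X|](_ : _ = complex.Re (f (x' +i* y')) -
    complex.Re (f (x +i* y)) - p * (x' - x) + q * (y' - y))//.
  by rewrite opprB addrA addrAC.
- apply: le_trans (D _ _ xx yy); apply: le_trans (ler_Im_modulus _).
  rewrite !raddfB /=.
  case: l {E D} => p q; rewrite /= [X in _ <= `|X|](_ : _ = complex.Im (f (x' +i* y')) -
    complex.Im (f (x +i* y)) - q * (x' - x) - p * (y' - y))//.
  by rewrite opprD addrA addrAC.
Qed.

End DifferentialApprox.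

Section CircleIntegral.
Context {R : realType}.
Implicit Types (f : R[i]^o -> R[i]^o) (r s t a b : R).

Definition circle_integral f r : R :=
  segment_integral 0 (2 * pi) (fun t => complex.Re (f (r%:C * cis t))).

Lemma polarE r t : r%:C * cis t = (r * cos t) +i* (r * sin t).
Proof. by rewrite /cis; apply/eqP; rewrite eq_complex/= !mul0r subr0 addr0 !eqxx. Qed.

Lemma modulus_polar r t : modulus (r%:C * cis t) = `|r|.
Proof. by rewrite modulusM modulus_cis mulr1 modulusC. Qed.

Lemma cis0 : cis 0 = 1 :> R[i].
Proof. by rewrite /cis cos0 sin0. Qed.

Lemma cis2pi : cis (2 * pi) = 1 :> R[i].
Proof. by rewrite /cis mulr_natl cos2pi sin2pi. Qed.

(** Goursat on the rectangle of polar coordinates, with [U] the real part of [f] and [W] its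
    imaginary part divided by the radius: the shared derivative is the polar Cauchy-Riemann
    equation. The sides at angles 0 and [2 * pi] cancel by periodicity, and the other two are the
    circle integrals. *)
Lemma circle_integral_annulus f a b : 0 < a -> a <= b ->
  (forall z, a <= modulus z <= b -> derivable f z 1) ->
  circle_integral f a = circle_integral f b.
Proof.
move=> a0 ab df.
pose U s t := complex.Re (f (s%:C * cis t)).
pose W s t := complex.Im (f (s%:C * cis t)) * s^-1.
have p0 : 0 <= 2 * pi :> R by rewrite mulr_ge0 ?pi_ge0.
suff dUW s t : a <= s <= b -> 0 <= t <= 2 * pi -> divergence_free U W s t.
  have := goursat ab p0 dUW.
  rewrite /W cis0 cis2pi subrr => /eqP; rewrite subr_eq0 => /eqP.
  by rewrite /circle_integral /U.
move=> sab _; have s0 : s != 0 by rewrite gt_eqF//; lra.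
have dfs : derivable f ((s * cos t) +i* (s * sin t)) 1.
  by rewrite -polarE; apply: df; rewrite modulus_polar ger0_norm//; lra.
have [p [q [ReA ImA]]] := cauchy_riemann dfs.
have idA : differential_approx (fun s _ : R => s) s t 1 0.
  exact: (@differential_approx_fst _ id).
have XA := differential_approxM idA
  (@differential_approx_snd _ _ s _ _ (is_derive_cos t)).
have YA := differential_approxM idA
  (@differential_approx_snd _ _ s _ _ (is_derive_sin t)).
have UA := @differential_approx_comp _ _ (fun s t => s * cos t)
  (fun s t => s * sin t) s t _ _ _ _ _ _ ReA XA YA.
have VA := @differential_approx_comp _ _ (fun s t => s * cos t)
  (fun s t => s * sin t) s t _ _ _ _ _ _ ImA XA YA.
have IA : differential_approx (fun s _ : R => s^-1) s t (- s ^- 2) 0.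
  apply: (@differential_approx_fst _ (fun s => s^-1)).
  have := @is_deriveV _ id s 1 1 s0 (is_derive_id (s : R^o) 1).
  by rewrite [_ *: _]mulr1.
have WA := differential_approxM VA IA.
rewrite /divergence_free.
have UE : U = fun s t => complex.Re (f ((s * cos t) +i* (s * sin t))).
  by apply/funext => x; apply/funext => y; rewrite /U polarE.
have WE : W = fun s t => complex.Im (f ((s * cos t) +i* (s * sin t))) * s^-1.
  by apply/funext => x; apply/funext => y; rewrite /W polarE.
rewrite UE WE; do 3 eexists; split; first exact: UA.
move: WA; set B := (X in differential_approx _ _ _ _ X) => WA.
have -> : p * (cos t * 1 + s * 0) + - q * (sin t * 1 + s * 0) = B.
  by rewrite /B; field.
exact: WA.
Qed.

Let cvg_polar_angle r t :
  (fun t => r%:C * cis t : R[i]^o) @ t --> (r%:C * cis t : R[i]^o).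
Proof.
rewrite (_ : (fun t => _) = (fun t => (r * cos t) +i* (r * sin t) : R[i]^o)).
  rewrite polarE; apply: cvg_complex; apply: cvgM; try exact: cvg_cst.
    exact: continuous_cos.
  exact: continuous_sin.
by apply/funext => x; rewrite polarE.
Qed.

Let cvg_polar_radius r t :
  (fun r => r%:C * cis t : R[i]^o) @ r --> (r%:C * cis t : R[i]^o).
Proof.
rewrite (_ : (fun r => _) = (fun r => (r * cos t) +i* (r * sin t) : R[i]^o)).
  rewrite polarE.
  by apply: cvg_complex; apply: cvgM; (exact: cvg_cst || exact: cvg_id).
by apply/funext => x; rewrite polarE.
Qed.

Let cvg_polar_pair (st : R * R) :
  (fun st : R * R => st.1%:C * cis st.2 : R[i]^o) @ st -->
  (st.1%:C * cis st.2 : R[i]^o).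
Proof.
rewrite (_ : (fun st => _) =
    (fun st : R * R => (st.1 * cos st.2) +i* (st.1 * sin st.2) : R[i]^o)).
  rewrite polarE; apply: cvg_complex; apply: cvgM; try exact: cvg_fst.
    by apply: (@cvg_comp _ _ _ snd cos); [exact: cvg_snd|exact: continuous_cos].
  by apply: (@cvg_comp _ _ _ snd sin); [exact: cvg_snd|exact: continuous_sin].
by apply/funext => x; rewrite polarE.
Qed.

Lemma continuous_polar f r t : {for r%:C * cis t, continuous f} ->
  {for t, continuous (fun t => f (r%:C * cis t))} /\
  {for r, continuous (fun r => f (r%:C * cis t))}.
Proof.
move=> cf; split.
  exact: (@cvg_comp _ _ _ (fun t => r%:C * cis t : R[i]^o) f _ _ _
    (@cvg_polar_angle r t) cf).
exact: (@cvg_comp _ _ _ (fun r => r%:C * cis t : R[i]^o) f _ _ _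
  (@cvg_polar_radius r t) cf).
Qed.

Lemma disk_compact r : 0 <= r -> compact [set z : R[i]^o | modulus z <= r].
Proof.
move=> r0.
have -> : [set z : R[i]^o | modulus z <= r] =
    [set (st.1)%:C * cis st.2 | st in `[0, r]%classic `*` `[0, 2 * pi]%classic].
  apply/seteqP; split=> [z /= zr|_ [[s t] /= [+ _] <-]]; last first.
    by rewrite in_itv/= modulus_polar => /andP[s0 sr]; rewrite ger0_norm.
  have [t [tp zE]] := polar z.
  by exists (modulus z, t); rewrite /= ?in_itv/= ?tp ?modulus_ge0.
apply: continuous_compact; last first.
  by apply: compact_setX; exact: segment_compact.
apply: continuous_in_subspaceT => st _; exact: cvg_polar_pair.
Qed.

Lemma continuous_bounded (K : set R[i]^o) (g : R[i]^o -> R) : compact K ->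
  (forall z, K z -> {for z, continuous g}) ->
  exists2 M, 0 < M & forall z, K z -> `|g z| <= M.
Proof.
move=> cK cg.
have : compact [set g z | z in K].
  apply: continuous_compact cK; apply: continuous_in_subspaceT => z.
  by rewrite inE; exact: cg.
move=> /(@compact_bounded _ R^o)[M [_ HM]].
exists (Num.max 0 M + 1); first by rewrite ltr_wpDl// le_max lexx.
move=> z Kz; apply: (HM (Num.max 0 M + 1)); last by exists z.
by rewrite ltr_pwDr// le_max lexx orbT.
Qed.

Lemma continuous_modulus_bounded f r : 0 <= r ->
  (forall z, modulus z <= r -> {for z, continuous f}) ->
  exists2 M, 0 < M & forall z, modulus z <= r -> modulus (f z) <= M.
Proof.
move=> r0 cf.
have [z zr|M M0 MP] := @continuous_bounded _ (fun z => modulus (f z)) (disk_compact r0).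
  exact: (@cvg_modulus _ _ _ _ f (f z) (cf z zr)).
by exists M => // z /MP; rewrite ger0_norm// modulus_ge0.
Qed.

Lemma continuous_between_circle f r a b :
  (forall z, modulus z = `|r| -> {for z, continuous f}) ->
  continuous_between a b (fun t => complex.Re (f (r%:C * cis t))).
Proof.
move=> cf t _; apply: cvg_Re.
by have [] := @continuous_polar f r t (cf _ (modulus_polar _ _)).
Qed.

(** Continuity under the integral sign, over a symmetric interval of radii: negative radii are
    allowed so that [r = 0] is an interior point. *)
Lemma circle_integral_continuous f r s : 0 <= r < s ->
  (forall z, modulus z < s -> {for z, continuous f}) ->
  {for r, continuous (circle_integral f)}.
Proof.
move=> /andP[r0 rs] cf.
pose v := (r + s) / 2; have [rv vs] : r < v /\ v < s by rewrite /v; lra.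
have [z zv|M M0 MP] := @continuous_modulus_bounded f v ltac:(lra).
  by apply: cf; lra.
have Iv x : `](- v), v[%classic x -> `|x| < v.
  by rewrite /= in_itv/= ltr_norml.
have H1 (x : R) : `](- v), v[%classic x -> lebesgue_measure.-integrable
    `[0, 2 * pi] (EFin \o (fun t => complex.Re (f (x%:C * cis t)))).
  move=> /Iv xv; apply: continuous_between_integrable.
  by apply: continuous_between_circle => z zx; apply: cf; lra.
have H2 : \forall t \ae (@lebesgue_measure R), `[0, 2 * pi]%classic t ->
    {in `](- v), v[%classic, continuous (fun x : R => complex.Re (f (x%:C * cis t)))}.
  apply: aeW => t _ x; rewrite inE => /Iv xv.
  have cx : {for x%:C * cis t, continuous f} by apply: cf; rewrite modulus_polar; lra.
  have [_ cr] := continuous_polar cx.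
  exact: (@cvg_Re _ _ _ _ (fun x : R => f (x%:C * cis t)) (f (x%:C * cis t)) cr).
have H3 : lebesgue_measure.-integrable `[0, 2 * pi] (EFin \o (fun=> M)).
  by apply: continuous_between_integrable; exact: continuous_between_cst.
have H4 (x : R) : `](- v), v[%classic x -> \forall t \ae (@lebesgue_measure R),
    `[0, 2 * pi]%classic t -> `|complex.Re (f (x%:C * cis t))| <= M.
  move=> /Iv xv; apply: aeW => t _.
  by rewrite (le_trans (ler_Re_modulus _))// MP// modulus_polar ltW.
have rI : r \in `](- v), v[%classic by rewrite inE/= in_itv/=; lra.
by have := @continuity_under_integral R _ _ (@lebesgue_measure R) _ _ _ _ _
  H1 H2 _ H3 H4; apply.
Qed.

(** Mere continuity on the two bounding circles suffices, by letting radii inside the annulus tend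
    to [a] and [b]. This admits exceptional points on these circles, and [a = 0]. *)
Lemma circle_integral_open_annulus f s a b : 0 <= a -> a <= b -> b < s ->
  (forall z, modulus z < s -> {for z, continuous f}) ->
  (forall z, a < modulus z < b -> derivable f z 1) ->
  circle_integral f a = circle_integral f b.
Proof.
move=> a0 ab bs cf df; have [->//|nab] := eqVneq a b.
have {nab}ab : a < b by rewrite lt_neqAle nab.
apply/eqP; rewrite -subr_eq0; apply: contraT => ne.
have e0 : 0 < `|circle_integral f a - circle_integral f b| / 2.
  by rewrite divr_gt0// normr_gt0.
have ca : {for a, continuous (circle_integral f)}.
  by apply: (@circle_integral_continuous f a s) => //; lra.
have cb : {for b, continuous (circle_integral f)}.
  by apply: (@circle_integral_continuous f b s) => //; lra.
move/cvgrPdist_lt : ca => /(_ _ e0) /nbhs_ballP[d1 /= d10 D1].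
move/cvgrPdist_lt : cb => /(_ _ e0) /nbhs_ballP[d2 /= d20 D2].
pose m := (a + b) / 2.
pose a' := Num.min m (a + d1 / 2); pose b' := Num.max m (b - d2 / 2).
have [a'1 a'2 a'3] : [/\ a < a', a' <= m & a' < a + d1].
  by rewrite lt_min ge_min gt_min lexx /m; split; lra.
have [b'1 b'2 b'3] : [/\ b' < b, m <= b' & b - d2 < b'].
  by rewrite gt_max le_max lt_max lexx /m; split; lra.
have := D1 a'; rewrite /ball/= ltr_norml => /(_ ltac:(lra)).
have := D2 b'; rewrite /ball/= ltr_norml => /(_ ltac:(lra)).
rewrite (@circle_integral_annulus f a' b'); [|lra|lra|move=> z zz; apply: df; lra].
set x := circle_integral f a; set y := circle_integral f b.
set w := circle_integral f b' => H1 H2.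
suff : `|x - y| < `|x - y| by rewrite ltxx.
have -> : x - y = (x - w) - (y - w) by lra.
rewrite (le_lt_trans (ler_normB _ _))//.
have -> : x - w - (y - w) = x - y by lra.
by rewrite [ltRHS]splitr ltrD.
Qed.

(** The annulus is cut along each exceptional circle, so only the moduli of the exceptional points
    matter. *)
Lemma circle_integral_off f s (E : seq R) a b : 0 <= a -> a <= b -> b < s ->
  (forall z, modulus z < s -> {for z, continuous f}) ->
  (forall z, a < modulus z < b -> modulus z \notin E -> derivable f z 1) ->
  circle_integral f a = circle_integral f b.
Proof.
elim: E a b => [|e E IH] a b a0 ab bs cf df.
  by apply: (@circle_integral_open_annulus f s) => // z zab; exact: df.
have [/andP[ae eb]|aeb] := boolP (a < e < b).
  transitivity (circle_integral f e); apply: IH => //; try lra.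
    move=> z zz zE; apply: df; first lra.
    by rewrite inE negb_or zE andbT; apply/eqP; lra.
  move=> z zz zE; apply: df; first lra.
  by rewrite inE negb_or zE andbT; apply/eqP; lra.
apply: IH => // z zz zE; apply: df => //.
by rewrite inE negb_or zE andbT; apply/eqP => ze; move: aeb; rewrite -ze zz.
Qed.

(** Made to be stable under difference quotients: [difference_quotient] adds its base point to [E],
    and the mean value property still holds. *)
Definition holomorphic_off s (E : seq R[i]^o) f :=
  (forall z, modulus z < s -> {for z, continuous f}) /\
  (forall z, modulus z < s -> z \notin E -> derivable f z 1).

(** The inner circle of the annulus is shrunk to radius 0, where the integrand is constant. *)
Lemma mean_value f s E r : holomorphic_off s E f -> 0 <= r < s ->
  circle_integral f r = complex.Re (f 0) * (2 * pi).
Proof.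
move=> [cf df] /andP[r0 rs].
rewrite -(@circle_integral_off f s (map modulus E) 0 r)//.
  rewrite /circle_integral.
  under eq_fun do rewrite mul0r.
  by rewrite segment_integral_cst ?mulr_ge0 ?pi_ge0// subr0.
move=> z /andP[_ zr] zE; apply: df; first lra.
by apply: contra zE => zE; apply/mapP; exists z.
Qed.

End CircleIntegral.

(** * Cauchy estimate *)

(* Restatements for functions from a field to itself: unifying the general
   lemmas directly with functions on [R[i]^o] does not terminate. *)
Section NumDerivable.
Context {K : numFieldType}.
Implicit Types (f g : K -> K) (x c : K).

Lemma derivableM_num f g x : derivable f x 1 -> derivable g x 1 ->
  derivable (fun x => f x * g x) x 1.
Proof. by move=> df dg; exact: derivableM. Qed.

Lemma derivableB_num f g x : derivable f x 1 -> derivable g x 1 ->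
  derivable (fun x => f x - g x) x 1.
Proof. by move=> df dg; exact: derivableB. Qed.

Lemma derivableD_num f g x : derivable f x 1 -> derivable g x 1 ->
  derivable (fun x => f x + g x) x 1.
Proof. by move=> df dg; exact: derivableD. Qed.

Lemma derivableV_num f x : f x != 0 -> derivable f x 1 ->
  derivable (fun x => (f x)^-1) x 1.
Proof. by move=> fx0 df; exact: derivableV. Qed.

Lemma derivable_cst_num c x : derivable (fun=> c) x 1.
Proof. exact: derivable_cst. Qed.

Lemma derivable_id_num x : derivable (fun x : K => x) x 1.
Proof. exact: derivable_id. Qed.

Lemma near_derivable_num f g x : (\forall y \near x, f y = g y) ->
  derivable f x 1 -> derivable g x 1.
Proof. by move=> fg; apply: near_eq_derivable. Qed.

Lemma near_continuous_num f g x : (\forall y \near x, f y = g y) ->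
  {for x, continuous f} -> {for x, continuous g}.
Proof.
move=> fg cf; have fgx : f x = g x by exact: nbhs_singleton fg.
suff : g @ x --> f x by rewrite fgx.
exact: (cvg_trans (near_eq_cvg fg) cf).
Qed.

Lemma continuousM_num f g x : {for x, continuous f} -> {for x, continuous g} ->
  {for x, continuous (fun x => f x * g x)}.
Proof. exact: continuousM. Qed.

Lemma continuousB_num f g x : {for x, continuous f} -> {for x, continuous g} ->
  {for x, continuous (fun x => f x - g x)}.
Proof. exact: continuousB. Qed.

Lemma continuousV_num f x : f x != 0 -> {for x, continuous f} ->
  {for x, continuous (fun x => (f x)^-1)}.
Proof. exact: continuousV. Qed.

End NumDerivable.

Section HolomorphicOff.
Context {R : realType}.
Implicit Types (f g : R[i]^o -> R[i]^o) (E : seq R[i]^o) (s r : R) (z : R[i]^o).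

Lemma holomorphic_offW s s' E E' f : s' <= s -> {subset E <= E'} ->
  holomorphic_off s E f -> holomorphic_off s' E' f.
Proof.
move=> ss EE [cf df]; split=> z zs; first by apply: cf; lra.
by move=> zE; apply: df; [lra|apply: contra zE => /EE].
Qed.

Lemma holomorphic_off_derivable s f :
  (forall z, modulus z < s -> derivable f z 1) -> holomorphic_off s [::] f.
Proof.
by move=> df; split=> z zs *; [apply: derivable_continuousC|]; exact: df.
Qed.

Lemma holomorphic_offM s E f g : holomorphic_off s E f -> holomorphic_off s E g ->
  holomorphic_off s E (fun z => f z * g z).
Proof.
move=> [cf df] [cg dg]; split=> z zs.
  by apply: (@continuousM_num R[i]); [exact: cf|exact: cg].
by move=> zE; apply: (@derivableM_num R[i]); [exact: df|exact: dg].
Qed.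

Lemma holomorphic_offB s E f g : holomorphic_off s E f -> holomorphic_off s E g ->
  holomorphic_off s E (fun z => f z - g z).
Proof.
move=> [cf df] [cg dg]; split=> z zs.
  by apply: (@continuousB_num R[i]); [exact: cf|exact: cg].
by move=> zE; apply: (@derivableB_num R[i]); [exact: df|exact: dg].
Qed.

Lemma holomorphic_offV s E f : (forall z, modulus z < s -> f z != 0) ->
  holomorphic_off s E f -> holomorphic_off s E (fun z => (f z)^-1).
Proof.
move=> f0 [cf df]; split=> z zs.
  by apply: (@continuousV_num R[i]); [exact: f0|exact: cf].
by move=> zE; apply: (@derivableV_num R[i]); [exact: f0|exact: df].
Qed.

Lemma holomorphic_off_cst s E c : holomorphic_off s E (fun=> c).
Proof.
apply: (@holomorphic_offW s s [::]) => //; apply: holomorphic_off_derivable => *.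
exact: (@derivable_cst_num R[i]).
Qed.

Lemma holomorphic_off_id s E : holomorphic_off s E id.
Proof.
apply: (@holomorphic_offW s s [::]) => //; apply: holomorphic_off_derivable => *.
exact: (@derivable_id_num R[i]).
Qed.

Lemma holomorphic_offX s E f n : holomorphic_off s E f ->
  holomorphic_off s E (fun z => f z ^+ n).
Proof.
move=> hf; elim: n => [|n IH].
  by under eq_fun do rewrite expr0; exact: holomorphic_off_cst.
by under eq_fun do rewrite exprS; exact: holomorphic_offM.
Qed.

(** The value of [q] at [z] is the derivative [l], which makes [q] continuous there. The last clause
    identifies [l] as the derivative, for the later distinction between zero and nonzero
    derivatives. *)
Lemma difference_quotient s E f z : holomorphic_off s E f -> modulus z < s ->
  derivable f z 1 -> exists l, exists q, [/\ holomorphic_off s (z :: E) q,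
    forall w, f w = f z + q w * (w - z), q z = l & forall e : R, 0 < e ->
      exists2 d : R, 0 < d & forall w, modulus (w - z) < d ->
      modulus (f w - f z - l * (w - z)) <= e * modulus (w - z)].
Proof.
move=> [cf df] zs dfz; have [l lP] := derivable_expansionC dfz.
pose q (w : R[i]^o) : R[i]^o := if w == z then l else (f w - f z) / (w - z).
have qE w : f w = f z + q w * (w - z).
  rewrite /q; have [->|wz] := eqVneq w z; first by rewrite subrr mulr0 addr0.
  by rewrite divfK ?subr_eq0// addrC subrK.
have qz : q z = l by rewrite /q eqxx.
have qn w : w != z -> \forall y \near (w : R[i]^o), (f y - f z) / (y - z) = q y.
  move=> wz; apply/near_cplx; exists (modulus (w - z)).
    by rewrite modulus_gt0 subr_eq0.
  move=> y yw; rewrite /q; case: eqP => // yz; move: yw.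
  by rewrite yz modulusB ltxx.
exists l, q; split; [|exact: qE|exact: qz|exact: lP]; split=> w ws.
- have [->|wz] := eqVneq w z.
    apply/(@ccvgrP _ _ (nbhs z) _ q (q z)) => e e0.
    have [d d0 D] := lP (e / 2) ltac:(by rewrite divr_gt0).
    apply/near_cplx; exists d => // y yz; rewrite qz /q.
    case: eqP => [_|/eqP ynz]; first by rewrite subrr modulus0.
    have yz0 : y - z != 0 by rewrite subr_eq0.
    have := D y yz; have -> : f y - f z - l * (y - z) =
      - ((l - (f y - f z) / (y - z)) * (y - z)) by rewrite mulrBl divfK// opprB.
    rewrite modulusN modulusM ler_pM2r ?modulus_gt0//.
    by lra.
  apply: (@near_continuous_num R[i] _ _ _ (qn _ wz)).
  apply: (@continuousM_num R[i]).
    apply: (@continuousB_num R[i]); first exact: cf.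
    exact: (derivable_continuousC (@derivable_cst_num R[i] (f z) w)).
  apply: (@continuousV_num R[i] (fun y => y - z)); first by rewrite subr_eq0.
  apply: (@continuousB_num R[i]).
    exact: (derivable_continuousC (@derivable_id_num R[i] w)).
  exact: (derivable_continuousC (@derivable_cst_num R[i] z w)).
- rewrite inE negb_or => /andP[wz wE].
  apply: (@near_derivable_num R[i] _ _ _ (qn _ wz)).
  apply: (@derivableM_num R[i]).
    apply: (@derivableB_num R[i]); first exact: df.
    exact: (@derivable_cst_num R[i]).
  apply: (@derivableV_num R[i] (fun y => y - z)); first by rewrite subr_eq0.
  apply: (@derivableB_num R[i]); first exact: (@derivable_id_num R[i]).
  exact: (@derivable_cst_num R[i]).
Qed.

Lemma mul_conj_modulus z : conjc z * z = (modulus z ^+ 2)%:C.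
Proof. by rewrite mulrC -sqr_normc normcE -rmorphXn. Qed.

Lemma Re_conj z : complex.Re (conjc z) = complex.Re z.
Proof. by case: z. Qed.

Lemma polar_sub_neq0 z r t : modulus z < r -> r%:C * cis t - z != 0.
Proof.
move=> zr; rewrite subr_eq0; apply: contraTneq zr => <-.
by rewrite modulus_polar -leNgt ler_norm.
Qed.

Lemma one_sub_neq0 z : modulus z < 1 -> 1 - z != 0.
Proof.
by apply: contraTneq => /eqP; rewrite subr_eq0 => /eqP <-; rewrite modulus1 ltxx.
Qed.

Lemma cauchy_kernel_mean z (c : R[i]) r : modulus z < r ->
  circle_integral (fun w => c * (w / (w - z))) r = complex.Re c * (2 * pi).
Proof.
move=> zr; have z0 := modulus_ge0 z; have r0 : 0 < r by rewrite (le_lt_trans z0).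
have r2 : (r ^+ 2)%:C != 0 :> R[i].
  by rewrite -modulus_eq0 modulusC normr_eq0 expf_neq0// gt_eqF.
pose k w := conjc c * (1 - conjc z / (r ^+ 2)%:C * w)^-1.
(* On the circle [conjc w = r ^+ 2 / w], so conjugating the kernel makes it
   holomorphic inside. *)
transitivity (circle_integral k r).
  congr segment_integral; apply/funext => t.
  rewrite -Re_conj; congr complex.Re.
  set w := r%:C * cis t; rewrite rmorphM; congr (_ * _).
  have wz : conjc (w - z) != 0 by rewrite conjc_eq0 polar_sub_neq0.
  have w0 : w != 0 by have := @polar_sub_neq0 0 r t; rewrite subr0 modulus0; apply.
  have u0 : conjc w != 0 by rewrite conjc_eq0.
  have uw : (r ^+ 2)%:C = conjc w * w :> R[i].
    by rewrite mul_conj_modulus modulus_polar real_normK ?num_real.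
  rewrite rmorphM fmorphV uw; move: wz; rewrite rmorphB => wz.
  rewrite -[RHS]invrK invrK; field.
  by rewrite u0 w0 wz.
(* The conjugated kernel has its pole, if any, at modulus [r ^ 2 / modulus z], hence at least
   [r ^ 2 / m], which exceeds [r]. Using [m] avoids a division by [modulus z], possibly 0. *)
pose m := (modulus z + r) / 2; have [m1 m2] : modulus z <= m /\ m < r.
  by rewrite /m; lra.
have m0 : 0 < m by rewrite /m; lra.
have rs : r < r ^+ 2 / m by rewrite ltr_pdivlMr// expr2 ltr_pM2l.
rewrite (@mean_value _ k (r ^+ 2 / m) [::] r); [|apply: holomorphic_offM|lra].
- by rewrite /k mulr0 subr0 invr1 mulr1 Re_conj.
- exact: holomorphic_off_cst.
apply: holomorphic_offV => [w ws|].
  apply: one_sub_neq0; rewrite !modulusM modulusV modulusJ modulusC.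
  rewrite ger0_norm ?sqr_ge0// mulrAC ltr_pdivrMr ?exprn_gt0// mul1r.
  move: ws; rewrite ltr_pdivlMr// mulrC; apply: le_lt_trans.
  by rewrite ler_wpM2r ?modulus_ge0.
apply: holomorphic_offB; first exact: holomorphic_off_cst.
apply: holomorphic_offM; first exact: holomorphic_off_cst.
exact: holomorphic_off_id.
Qed.

Lemma unit_rotation z : exists2 c : R[i], modulus c = 1 & c * z = (modulus z)%:C.
Proof.
have [->|z0] := eqVneq z 0; first by exists 1; rewrite ?modulus1// mul1r modulus0.
have m0 : modulus z != 0 by rewrite modulus_eq0.
have mC : (modulus z)%:C != 0 :> R[i].
  by rewrite -modulus_eq0 modulusC normr_eq0.
exists (conjc z / (modulus z)%:C).
  rewrite modulusM modulusV modulusJ modulusC ger0_norm ?modulus_ge0//.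
  by rewrite divff.
by rewrite mulrAC mul_conj_modulus rmorphXn expr2 mulfK.
Qed.

Lemma circle_integralE f r : circle_integral f r =
  segment_integral 0 (2 * pi) (fun t => complex.Re (f (r%:C * cis t))).
Proof. by []. Qed.

Lemma two_pi_gt0 : 0 < 2 * pi :> R.
Proof. by rewrite mulr_gt0// pi_gt0. Qed.

Lemma continuous_between_circle_modulus f r a b :
  (forall z, modulus z = `|r| -> {for z, continuous f}) ->
  continuous_between a b (fun t => modulus (f (r%:C * cis t))).
Proof.
move=> cf t _; have [cr _] := @continuous_polar _ f r t (cf _ (modulus_polar _ _)).
exact: (@cvg_modulus _ _ _ _ (fun t => f (r%:C * cis t)) (f (r%:C * cis t)) cr).
Qed.

(** Cauchy's formula through real parts: [w * f w / (w - z)] is [w * q w], which vanishes at 0 and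
    so has mean 0, plus the kernel [f z * (w / (w - z))], whose mean is given by
    [cauchy_kernel_mean]. The rotation [c] turns [f z] into its modulus, so that no information is
    lost in the real part. *)
Lemma cauchy_estimate s E f z r : holomorphic_off s E f -> z \notin E ->
  modulus z < r -> r < s ->
  (r - modulus z) * (modulus (f z) * (2 * pi)) <=
  r * segment_integral 0 (2 * pi) (fun t => modulus (f (r%:C * cis t))).
Proof.
move=> hf zE zr rs; have z0 := modulus_ge0 z.
have r0 : 0 < r by rewrite (le_lt_trans z0).
have nr : `|r| = r by rewrite ger0_norm// ltW.
have dfz : derivable f z 1 by apply: hf.2 => //; lra.
have [l [q [hq fE _ _]]] := difference_quotient hf (lt_trans zr rs) dfz.
have [c c1 cz] := unit_rotation (f z).
have h1 : holomorphic_off s (z :: E) (fun w => c * (w * q w)).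
  apply: holomorphic_offM; first exact: holomorphic_off_cst.
  by apply: holomorphic_offM; [exact: holomorphic_off_id|exact: hq].
have M1 : circle_integral (fun w => c * (w * q w)) r = 0.
  have rs' : 0 <= r < s by rewrite (ltW r0).
  by rewrite (mean_value h1 rs') [0 * _]mul0r [c * 0]mulr0 mul0r.
have M2 := @cauchy_kernel_mean z (c * f z) r zr.
have cq (w : R[i]^o) : modulus w = `|r| ->
    {for w, continuous (fun w : R[i]^o => c * (w * q w) : R[i]^o)}.
  by move=> wr; apply: h1.1; rewrite wr nr.
have ck (w : R[i]^o) : modulus w = `|r| ->
    {for w, continuous (fun w : R[i]^o => c * f z * (w / (w - z)) : R[i]^o)}.
  move=> wr; have wz : w - z != 0.
    by rewrite subr_eq0; apply: contraTneq zr => <-; rewrite wr nr ltxx.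
  apply: derivable_continuousC.
  apply: (@derivableM_num R[i]); first exact: (@derivable_cst_num R[i]).
  apply: (@derivableM_num R[i]); first exact: (@derivable_id_num R[i]).
  apply: (@derivableV_num R[i] (fun w => w - z)); first exact: wz.
  apply: (@derivableB_num R[i]); first exact: (@derivable_id_num R[i]).
  exact: (@derivable_cst_num R[i]).
have cf (w : R[i]^o) : modulus w = `|r| -> {for w, continuous f}.
  by move=> wr; apply: hf.1; rewrite wr nr.
have cI1 := continuous_between_circle (a := 0) (b := 2 * pi) cq.
have cI2 := continuous_between_circle (a := 0) (b := 2 * pi) ck.
have cI3 := continuous_between_circle_modulus (a := 0) (b := 2 * pi) cf.
have -> : modulus (f z) * (2 * pi) = segment_integral 0 (2 * pi) (fun t =>
    complex.Re (c * (r%:C * cis t * q (r%:C * cis t))) +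
    complex.Re (c * f z * (r%:C * cis t / (r%:C * cis t - z)))).
  rewrite segment_integralD; [|exact: cI1|exact: cI2].
  transitivity (circle_integral (fun w => c * (w * q w)) r +
    circle_integral (fun w => c * f z * (w / (w - z))) r); last by [].
  by rewrite M1 M2 cz add0r.
rewrite -!segment_integralZ//; last first.
  by move=> t tI; apply: cvgD; [exact: cI1|exact: cI2].
apply: segment_integral_le => [t tI|t tI|t tI].
- apply: cvgM; first exact: cvg_cst.
  by apply: cvgD; [exact: cI1|exact: cI2].
- by apply: cvgM; [exact: cvg_cst|exact: cI3].
set w := r%:C * cis t.
have wz : w - z != 0 by rewrite polar_sub_neq0.
rewrite -raddfD /=.
have -> : c * (w * q w) + c * f z * (w / (w - z)) = c * (w * f w / (w - z)).
  by rewrite (fE w); field.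
have rz : 0 < r - modulus z by lra.
have wr : modulus w = r by rewrite modulus_polar nr.
have rw : r - modulus z <= modulus (w - z).
  by have := modulusD (w - z) z; rewrite subrK wr; lra.
apply: (@le_trans _ _ ((r - modulus z) * modulus (c * (w * f w / (w - z))))).
  by rewrite ler_pM2l// (le_trans (ler_norm _))// ler_Re_modulus.
clearbody w; rewrite !modulusM modulusV c1 mul1r wr mulrA ler_pdivrMr; last first.
  by rewrite modulus_gt0.
rewrite mulrC ler_wpM2l// mulr_ge0 ?modulus_ge0// ltW//.
Qed.

End HolomorphicOff.

(** * Maximum principles *)

Section BoundaryMaximum.
Context {R : realType}.
Implicit Types (f g : R[i]^o -> R[i]^o) (E : seq R[i]^o) (s r : R) (z : R[i]^o).

Lemma lebesgue_ae_imply (P Q : R -> Prop) : (forall t, P t -> Q t) ->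
  (\forall t \ae (@lebesgue_measure R), P t) ->
  \forall t \ae (@lebesgue_measure R), Q t.
Proof.
move=> PQ [N [mN N0 sub]]; exists N; split=> //.
by apply: subset_trans sub => t /=; apply: contra_not; exact: PQ.
Qed.

Lemma bounded_convergence (g : nat -> R -> R) (l M : R) :
  (forall n, continuous_between 0 (2 * pi) (g n)) ->
  (forall n t, 0 <= t <= 2 * pi -> `|g n t| <= M) ->
  (\forall t \ae (@lebesgue_measure R), t \in `[0, 2 * pi] ->
    g n t @[n --> \oo] --> l) ->
  segment_integral 0 (2 * pi) (g n) @[n --> \oo] --> l * (2 * pi).
Proof.
move=> cg gM gl; have p0 := two_pi_gt0 (R := R).
have ig n := continuous_between_integrable (cg n).
have mg n := measurable_int _ (ig n).
have iM := continuous_between_integrable (@continuous_between_cst R 0 (2 * pi) M).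
have il := continuous_between_integrable (@continuous_between_cst R 0 (2 * pi) l).
have cvg_ae : {ae (@lebesgue_measure R), forall x, `[0, 2 * pi]%classic x ->
    (EFin \o g n) x @[n --> \oo] --> (EFin \o (fun=> l)) x}.
  move: gl; apply: lebesgue_ae_imply => t tl tI; apply: cvg_EFin; first exact: nearW.
  exact: tl.
have dom_ae : {ae (@lebesgue_measure R), forall x (n : nat),
    `[0, 2 * pi]%classic x -> (`|(EFin \o g n) x| <= (EFin \o (fun=> M)) x)%E}.
  apply: aeW => t n; rewrite /= in_itv/= => tI; rewrite lee_fin; exact: gM.
have [_ _] := @dominated_convergence _ _ _ lebesgue_measure _
  (measurable_itv `[0, 2 * pi]) (fun n => EFin \o g n) (EFin \o (fun=> l))
  (EFin \o (fun=> M)) mg (measurable_int _ il) cvg_ae iM dom_ae.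
have -> : l * (2 * pi) = segment_integral 0 (2 * pi) (fun=> l).
  by rewrite segment_integral_cst ?subr0// ltW.
move=> H.
apply: fine_cvg; rewrite fineK; first exact: H.
exact: integrable_fin_num.
Qed.

(** The shift to [n.+2] makes the first radius 1/2, so that all of them are positive. *)
Lemma radius_itv n : 0 < (1 - n.+2%:R^-1 : R) < 1.
Proof.
rewrite subr_gt0 gtrBl invr_gt0 ltr0n andbT.
by rewrite invf_lt1 ?ltr0n// ltr1n.
Qed.

Lemma radius_cvg : (fun n => 1 - n.+2%:R^-1 : R) @ \oo --> (1 : R)^'-.
Proof.
have H : (fun n => 1 - n.+2%:R^-1 : R) @ \oo --> (1 : R).
  rewrite -[X in _ --> X]subr0; apply: cvgB; first exact: cvg_cst.
  rewrite (_ : (fun n => _) = fun n => (harmonic (n + 1)%N : R)).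
    by rewrite (cvg_shiftn 1 (@harmonic R)); exact: cvg_harmonic.
  by apply/funext => n; rewrite /harmonic addn1.
move=> P /nbhs_ballP[e e0 eP].
move/cvgrPdist_lt : H => /(_ e e0); apply: filterS => n ne.
by apply: eP => //=; have /andP[] := radius_itv n.
Qed.

(* The powers of [f] all satisfy the Cauchy estimate with the same constant. *)
Lemma boundary_maximum f E (C : R) : holomorphic_off 1 E f ->
  (forall z, modulus z < 1 -> modulus (f z) <= C) ->
  (\forall t \ae (@lebesgue_measure R), t \in `[0, 2 * pi] ->
    modulus (f (r%:C * cis t)) @[r --> (1 : R)^'-] --> (1 : R)) ->
  forall z, modulus z < 1 -> z \notin E -> modulus (f z) <= 1.
Proof.
move=> hf fC fl z z1 zE; have p0 := two_pi_gt0 (R := R).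
have C0 : 0 <= C by rewrite (le_trans (modulus_ge0 (f 0)))// fC// modulus0 ltr01.
pose rad n : R := 1 - n.+2%:R^-1.
have z0 := modulus_ge0 z.
(* For a radius close enough to 1, depending on [n], the mean of the [n]-th power is below 2 and the
   distance to [modulus z] exceeds [(1 - modulus z) / 2]; hence the 4. As this bound is uniform in
   [n], [modulus (f z)] cannot exceed 1. *)
have pow n : modulus (f z) ^+ n * ((1 - modulus z) / 4) <= 1.
  pose g k t := modulus (f ((rad k)%:C * cis t) ^+ n).
  have hfn := holomorphic_offX n hf.
  have cg k : continuous_between 0 (2 * pi) (g k).
    apply: (@continuous_between_circle_modulus _ (fun z => f z ^+ n)) => w wr.
    apply: hfn.1; rewrite wr ger0_norm; have := radius_itv k; rewrite -/(rad k); lra.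
  have gM k t : 0 <= t <= 2 * pi -> `|g k t| <= C ^+ n.
    move=> _; rewrite ger0_norm ?modulus_ge0// /g modulusX.
    rewrite lerXn2r ?nnegrE ?modulus_ge0//; apply: fC.
    by rewrite modulus_polar ger0_norm; have := radius_itv k; rewrite -/(rad k); lra.
  have gl : \forall t \ae (@lebesgue_measure R), t \in `[0, 2 * pi] ->
      g k t @[k --> \oo] --> (1 : R).
    move: fl; apply: lebesgue_ae_imply => t tl tI; have {}tl := tl tI.
    have -> : (fun k => g k t) =
        (fun x : R => x ^+ n) \o (fun k => modulus (f ((rad k)%:C * cis t))).
      by apply/funext => k; rewrite /g modulusX.
    have gk : (fun k => modulus (f ((rad k)%:C * cis t))) @ \oo --> (1 : R).
      exact: (cvg_comp _ _ radius_cvg tl).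
    by have := cvg_comp _ _ gk (@exprn_continuous R n 1); rewrite expr1n.
  have [N1 _ H1] : \forall k \near \oo,
      segment_integral 0 (2 * pi) (g k) < 2 * (2 * pi).
    by apply: (cvgr_lt _ (bounded_convergence cg gM gl)); lra.
  have [N2 _ H2] : \forall k \near \oo, (1 + modulus z) / 2 < rad k.
    have lt1 : (1 + modulus z) / 2 < 1 by lra.
    exact: (radius_cvg (nbhs_left_gt lt1)).
  pose k := (N1 + N2)%N.
  have {}H1 := H1 k (leq_addr _ _); have {}H2 := H2 k (leq_addl _ _).
  have rk := radius_itv k; rewrite -/(rad k) in rk.
  have := @cauchy_estimate _ _ E (fun z => f z ^+ n) z (rad k) hfn zE ltac:(lra) ltac:(lra).
  rewrite -[segment_integral _ _ _]/(segment_integral 0 (2 * pi) (g k)).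
  rewrite modulusX => CE.
  have fn0 : 0 <= modulus (f z) ^+ n by rewrite exprn_ge0 ?modulus_ge0.
  rewrite -(@ler_pM2r _ (2 * pi))// mul1r.
  have A1 : (1 - modulus z) / 2 * (modulus (f z) ^+ n * (2 * pi)) <=
      (rad k - modulus z) * (modulus (f z) ^+ n * (2 * pi)).
    by rewrite ler_wpM2r// ?mulr_ge0// ?ltW//; lra.
  have A2 : rad k * segment_integral 0 (2 * pi) (g k) <= 2 * (2 * pi).
    apply: (@le_trans _ _ (rad k * (2 * (2 * pi)))).
      by rewrite ler_wpM2l//; lra.
    by rewrite ler_piMl//; lra.
  have := le_trans A1 (le_trans CE A2).
  by clear; lra.
rewrite leNgt; apply/negP => fz1.
have fz0 : 0 < modulus (f z) by lra.
have : (fun n => (modulus (f z))^-1 ^+ n) @ \oo --> (0 : R).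
  by apply: cvg_expr; rewrite ger0_norm ?invr_ge0 ?ltW// invf_lt1.
have z4 : 0 < (1 - modulus z) / 4 by lra.
move=> /cvgr_lt /(_ _ z4) [n _ /(_ n (leqnn n))] /=.
rewrite exprVn ltNge => /negP; apply.
by rewrite -(@ler_pM2l _ (modulus (f z) ^+ n)) ?exprn_gt0// divff// gt_eqF ?exprn_gt0.
Qed.

Lemma segment_integral_eq0 (u : R -> R) (a b : R) : a < b ->
  continuous_between a b u -> (forall t, a <= t <= b -> 0 <= u t) ->
  segment_integral a b u <= 0 -> forall t, a <= t <= b -> u t = 0.
Proof.
move=> ab cu u0 iu t tab; apply/eqP; rewrite eq_le u0// andbT leNgt.
apply/negP => ut.
have /(cvgr_gt (u t)) /(_ (u t / 2) ltac:(lra)) /nbhs_ballP[d /= d0 D] := cu t tab.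
pose x := Num.max a (t - d / 2); pose y := Num.min b (t + d / 2).
have [ax xt xd] : [/\ a <= x, x <= t & t - d < x].
  by rewrite le_max ge_max lt_max lexx; split; lra.
have [yb ty yd] : [/\ y <= b, t <= y & y < t + d].
  by rewrite ge_min le_min gt_min lexx; split; lra.
have xy : x < y.
  rewrite /x /y gt_max !lt_min; apply/andP; split; lra.
have D' w : x <= w <= y -> u t / 2 <= u w.
  move=> wxy; apply: ltW; apply: D; rewrite /ball/= ltr_norml; lra.
have c1 : continuous_between a x u by apply: continuous_betweenW cu; lra.
have c2 : continuous_between x y u by apply: continuous_betweenW cu; lra.
have c3 : continuous_between y b u by apply: continuous_betweenW cu; lra.
have c4 : continuous_between x b u by apply: continuous_betweenW cu; lra.
have i1 : 0 <= segment_integral a x u.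
  by apply: Rintegral_ge0 => w /=; rewrite in_itv/= => wI; apply: u0; lra.
have i3 : 0 <= segment_integral y b u.
  by apply: Rintegral_ge0 => w /=; rewrite in_itv/= => wI; apply: u0; lra.
have i2 : u t / 2 * (y - x) <= segment_integral x y u.
  rewrite -(segment_integral_cst _ (ltW xy)); apply: segment_integral_le => //.
  exact: continuous_between_cst.
have pos : 0 < u t / 2 * (y - x) by rewrite mulr_gt0//; lra.
move: iu; rewrite (@segment_integral_split _ a x b)//; [|lra].
rewrite (@segment_integral_split _ x y b)//; [|lra].
by move: i1 i2 i3 pos; clear; lra.
Qed.

Lemma Re_eq1 z : modulus z <= 1 -> complex.Re z = 1 -> z = 1.
Proof.
move=> z1 Re1; have : modulus z ^+ 2 <= 1 by rewrite expr_le1// modulus_ge0.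
rewrite modulus_sqr Re1 expr1n gerDl => I0.
have /eqP : complex.Im z ^+ 2 = 0 by apply/eqP; rewrite eq_le I0 sqr_ge0.
rewrite sqrf_eq0 => /eqP Im0.
by apply/eqP; rewrite eq_complex Re1 Im0 /= !eqxx.
Qed.

(** Multiplied by the conjugate of [f 0], the function takes the value 1 at 0. Then 1 minus its real
    part is nonnegative with mean 0 on each circle, hence vanishes, and a number of modulus at most
    1 with real part 1 is 1. *)
Lemma center_maximum f E : holomorphic_off 1 E f ->
  (forall z, modulus z < 1 -> modulus (f z) <= 1) -> modulus (f 0) = 1 ->
  forall z, modulus z < 1 -> f z = f 0.
Proof.
move=> hf f1 f01 z z1; have p0 := two_pi_gt0 (R := R).
have f00 : f 0 != 0 by rewrite -modulus_eq0 f01 oner_eq0.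
have cf0 : conjc (f 0) * f 0 = 1 by rewrite mul_conj_modulus f01 expr1n.
pose h w := conjc (f 0) * f w.
have hh : holomorphic_off 1 E h.
  by apply: holomorphic_offM; [exact: holomorphic_off_cst|exact: hf].
have h1 w : modulus w < 1 -> modulus (h w) <= 1.
  by move=> w1; rewrite /h modulusM modulusJ f01 mul1r f1.
suff : h z = 1.
  move=> hz; have : f 0 * h z = f z.
    by rewrite /h mulrA [f 0 * _]mulrC cf0 mul1r.
  by rewrite hz mulr1.
apply: Re_eq1; first exact: h1.
have [t [tI zE]] := polar z; pose r := modulus z.
have r1 : 0 <= r < 1 by rewrite modulus_ge0.
have M := mean_value hh r1.
have ch : continuous_between 0 (2 * pi) (fun t => complex.Re (h (r%:C * cis t))).
  by apply: continuous_between_circle => w wr; apply: hh.1; rewrite wr ger0_norm; lra.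
have c1 : continuous_between 0 (2 * pi) (fun=> 1 : R) := @continuous_between_cst _ _ _ _.
have := @segment_integral_eq0 (fun t => 1 - complex.Re (h (r%:C * cis t))) 0 (2 * pi) p0 _ _ _ t tI.
rewrite -zE => H; apply/eqP; rewrite eq_sym -subr_eq0; apply/eqP; apply: H.
- exact: continuous_betweenB.
- move=> w _; rewrite subr_ge0 (le_trans (ler_norm _))//.
  by rewrite (le_trans (ler_Re_modulus _))// h1// modulus_polar ger0_norm; lra.
- rewrite segment_integralB// (segment_integral_cst _ (ltW p0)) -circle_integralE M.
  by rewrite /h cf0 /=; lra.
Qed.

End BoundaryMaximum.

(** * Involutive automorphisms of the disk *)

Section Moebius.
Context {R : realType}.
Implicit Types (a z w : R[i]^o).

Definition moebius a : R[i]^o -> R[i]^o := fun z => (a - z) / (1 - conjc a * z).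

Lemma moebius_den a z : modulus a < 1 -> modulus z <= 1 -> 1 - conjc a * z != 0.
Proof.
move=> a1 z1; apply: one_sub_neq0; rewrite modulusM modulusJ.
by apply: le_lt_trans a1; rewrite ler_piMr// modulus_ge0.
Qed.

(** The sign of one side decides that of the other: the disk and the circle are both preserved. *)
Lemma moebius_modulus a z : modulus a < 1 -> modulus z <= 1 ->
  (1 - modulus (moebius a z) ^+ 2) * modulus (1 - conjc a * z) ^+ 2 =
  (1 - modulus a ^+ 2) * (1 - modulus z ^+ 2).
Proof.
move=> a1 z1; have d0 := moebius_den a1 z1.
have dm : modulus (1 - conjc a * z) != 0 by rewrite modulus_eq0.
rewrite /moebius modulusM modulusV exprMn exprVn mulrBl mul1r divfK ?expf_neq0//.
by case: a z {a1 z1 d0 dm} => [a b] [x y]; rewrite !modulus_sqr /=; ring.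
Qed.

Lemma moebius_disk a z : modulus a < 1 -> modulus z < 1 -> modulus (moebius a z) < 1.
Proof.
move=> a1 z1; have := moebius_modulus a1 (ltW z1).
have : 0 < (1 - modulus a ^+ 2) * (1 - modulus z ^+ 2).
  by rewrite mulr_gt0// subr_gt0 expr_lt1// modulus_ge0.
move=> + E; rewrite -E pmulr_lgt0; last first.
  by rewrite exprn_gt0// modulus_gt0 moebius_den// ltW.
by rewrite subr_gt0 expr_lt1// modulus_ge0.
Qed.

Lemma moebius_circle a z : modulus a < 1 -> modulus z = 1 -> modulus (moebius a z) = 1.
Proof.
move=> a1 z1; have z1' : modulus z <= 1 by rewrite z1.
have := moebius_modulus a1 z1'; rewrite z1 expr1n subrr mulr0 => /eqP.
rewrite mulf_eq0 sqrf_eq0 modulus_eq0 (negbTE (moebius_den a1 z1')) orbF.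
by rewrite subr_eq0 eq_sym sqrf_eq1 => /orP[/eqP//|/eqP E]; have := modulus_ge0 (moebius a z); lra.
Qed.

Lemma moebiusK a z : modulus a < 1 -> modulus z < 1 -> moebius a (moebius a z) = z.
Proof.
move=> a1 z1; have d0 := moebius_den a1 (ltW z1).
have aa : 1 - conjc a * a != 0 by apply: moebius_den => //; exact: ltW.
rewrite /moebius; field; rewrite d0 /=.
by have -> : 1 - conjc a * z - conjc a * (a - z) = 1 - conjc a * a by ring.
Qed.

Lemma moebius_derivable a z : modulus a < 1 -> modulus z <= 1 -> derivable (moebius a) z 1.
Proof.
move=> a1 z1.
apply: (@derivableM_num R[i]).
  apply: (@derivableB_num R[i]); first exact: (@derivable_cst_num R[i]).
  exact: (@derivable_id_num R[i]).
apply: (@derivableV_num R[i] (fun z => 1 - conjc a * z)); first exact: moebius_den.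
apply: (@derivableB_num R[i]); first exact: (@derivable_cst_num R[i]).
apply: (@derivableM_num R[i]); first exact: (@derivable_cst_num R[i]).
exact: (@derivable_id_num R[i]).
Qed.

Lemma moebius_eq0 a z : modulus a < 1 -> modulus z <= 1 -> moebius a z = 0 -> z = a.
Proof.
move=> a1 z1 /eqP; rewrite mulf_eq0 invr_eq0 (negbTE (moebius_den a1 z1)) orbF.
by rewrite subr_eq0 => /eqP.
Qed.

End Moebius.

(** * Bounds for inner functions *)

Section InnerFunctions.
Context {R : realType}.
Implicit Types (f h : R[i]^o -> R[i]^o).

Lemma holomorphicW f E : holomorphic f -> holomorphic_off 1 E f.
Proof.
move=> hf; apply: (@holomorphic_offW _ 1 1 [::]) => //.
by apply: holomorphic_off_derivable => z z1; apply: hf; rewrite diskE.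
Qed.

Lemma inner_radial h : inner h -> \forall t \ae (@lebesgue_measure R),
  t \in `[0, 2 * pi] -> modulus (h (r%:C * cis t)) @[r --> (1 : R)^'-] --> (1 : R).
Proof.
move=> [_ _]; apply: lebesgue_ae_imply => t tl tI; have [l hl l1] := tl tI.
have lm : modulus l = 1 by apply: complexI; rewrite -normcE l1.
suff : modulus (h (r%:C * cis t)) @[r --> (1 : R)^'-] --> modulus l by rewrite lm.
exact: (@cvg_modulus R _ _ _ (fun r : R => h (r%:C * cis t)) l hl).
Qed.

Lemma inner_le1 h : inner h -> forall z, modulus z < 1 -> modulus (h z) <= 1.
Proof.
move=> hh z z1; have hr := inner_radial hh; case: hh => hh [C hC] _.
apply: (@boundary_maximum _ h [::] C) => //; first exact: holomorphicW.
by move=> w w1; rewrite -lecR -normcE; apply: hC; rewrite diskE.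
Qed.

(** [center_maximum] only sees the centre; composing with [moebius z], which exchanges 0 and [z],
    brings any point there. *)
Lemma inner_nonconstant h : inner h -> ~ constant_on_disk h ->
  forall z, modulus z < 1 -> modulus (h z) < 1.
Proof.
move=> hh hn z z1; rewrite lt_neqAle inner_le1// andbT; apply/eqP => hz.
apply: hn; exists (h z) => w; rewrite inE diskE => w1.
have m0 : moebius z 0 = z by rewrite /moebius mulr0 !subr0 divr1.
have hol : holomorphic_off 1 [::] (h \o moebius z).
  apply: holomorphic_off_derivable => x x1; apply: derivable_compC.
    by apply: moebius_derivable => //; exact: ltW.
  by case: hh => hh _ _; apply: hh; rewrite diskE; exact: moebius_disk.
have le1 x : modulus x < 1 -> modulus ((h \o moebius z) x) <= 1.
  by move=> x1; exact: (inner_le1 hh (moebius_disk z1 x1)).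
have eq1 : modulus ((h \o moebius z) 0) = 1 by rewrite /= m0.
by have := center_maximum hol le1 eq1 (moebius_disk z1 w1); rewrite /= m0 moebiusK.
Qed.

End InnerFunctions.

(** * Injective inner functions *)

Section InjectiveInner.
Context {R : realType}.
Implicit Types (f : R[i]^o -> R[i]^o) (z w : R[i]^o).

(* Goursat for the field [(u, 0)], where [u s] is a multiple of [f] on the
   segment from 0 to [z]. *)
Lemma zero_derivative_constant f :
  (forall z, modulus z < 1 -> forall e : R, 0 < e -> exists2 d : R, 0 < d &
     forall w, modulus (w - z) < d -> modulus (f w - f z) <= e * modulus (w - z)) ->
  forall z, modulus z < 1 -> f z = f 0.
Proof.
move=> f0 z z1; have [c c1 cf] := unit_rotation (f z - f 0).
have z0 := modulus_ge0 z.
pose u s := complex.Re (c * f (s%:C * z)).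
have dU s t : 0 <= s <= 1 -> 0 <= t <= 1 ->
    divergence_free (fun s _ : R => u s) (fun _ _ => 0) s t.
  move=> s01 _; exists 0, 0, 0; split=> eta eta0; last first.
    by exists 1 => // *; rewrite !mul0r !subrr normr0 mulr_ge0 ?addr_ge0// ltW.
  have sz1 : modulus (s%:C * z) < 1.
    rewrite modulusM modulusC (le_lt_trans _ z1)// ler_piMl// ger0_norm; lra.
  have [d d0 D] := f0 _ sz1 eta eta0; exists d => // s' t' ss' _.
  rewrite !mul0r !subr0 /u -raddfB -mulrBr.
  have E : modulus (s'%:C * z - s%:C * z) = `|s' - s| * modulus z.
    by rewrite -mulrBl -rmorphB modulusM modulusC.
  have E1 : `|s' - s| * modulus z <= `|s' - s| by rewrite ler_piMr// ltW.
  rewrite (le_trans (ler_Re_modulus _))// modulusM c1 mul1r.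
  rewrite (le_trans (D _ _))// ?E; first exact: le_lt_trans E1 ss'.
  rewrite ler_pM2l// (le_trans E1)// lerDl//.
have := goursat ler01 ler01 dU.
rewrite !segment_integral_cst// !mul0r subrr !subr0 !mulr1 /u => /eqP.
rewrite rmorph1 rmorph0 mul1r mul0r -raddfB -mulrBr cf /= => /eqP m0.
by apply/eqP; rewrite -subr_eq0 -modulus_eq0 m0.
Qed.

(** Serves to reach an exceptional point, about which [boundary_maximum] is silent. The approach is
    along [z + h] with [h] real and positive. *)
Lemma continuous_constant_modulus f z (m : R) : {for z, continuous f} ->
  (forall w, modulus w < 1 -> w != z -> modulus (f w) = m) -> modulus z < 1 ->
  modulus (f z) = m.
Proof.
move=> cf fm z1; apply/eqP; rewrite -subr_eq0 -normr_eq0.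
apply: contraT => ne; have e0 : 0 < `|modulus (f z) - m| by rewrite lt_neqAle eq_sym ne /=.
move/ccvgrP : cf => /(_ _ e0) /near_cplx[d d0 D].
pose h : R := Num.min (d / 2) ((1 - modulus z) / 2).
have [h0 hd h1] : [/\ 0 < h, h < d & h < 1 - modulus z].
  by rewrite lt_min !gt_min; split; lra.
have mh : modulus h%:C = h by rewrite modulusC ger0_norm// ltW.
have := D (z + h%:C); rewrite [z + _ - _]addrC addKr mh => /(_ hd).
have w1 : modulus (z + h%:C) < 1.
  by rewrite (le_lt_trans (modulusD _ _))// mh; lra.
have wz : z + h%:C != z.
  by rewrite -subr_eq0 [z + _ - _]addrC addKr -modulus_eq0 mh gt_eqF.
rewrite -(fm _ w1 wz) => H; exfalso; move: H; apply/negP; rewrite -leNgt.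
have := modulusD (f z - f (z + h%:C)) (f (z + h%:C)).
have := modulusD (f (z + h%:C) - f z) (f z).
rewrite !subrK (modulusB (f (z + h%:C))) => A B.
by rewrite ler_norml; apply/andP; split; lra.
Qed.

Section Rigidity.
Variable phi : R[i]^o -> R[i]^o.
Hypotheses (phi_inner : inner phi)
  (phi_disk : forall z, modulus z < 1 -> modulus (phi z) < 1)
  (phi_inj : forall z w, modulus z < 1 -> modulus w < 1 -> phi z = phi w -> z = w).

Let phi_hol E : holomorphic_off 1 E phi.
Proof. by case: phi_inner => h _ _; exact: holomorphicW. Qed.

Variables (z0 : R[i]^o) (q : R[i]^o -> R[i]^o).
Hypotheses (z01 : modulus z0 < 1) (q_hol : holomorphic_off 1 [:: z0] q)
  (qE : forall w, phi w = phi z0 + q w * (w - z0)) (qz0 : q z0 != 0).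

Let q_neq0 w : modulus w < 1 -> q w != 0.
Proof.
move=> w1; have [->//|wz] := eqVneq w z0; apply: contraNneq wz => qw.
by apply/eqP/phi_inj => //; rewrite qE qw mul0r addr0.
Qed.

(** The Cauchy estimate at [z0] is taken on the circle of radius [r2], strictly inside the disk of
    radius [r1] where values close to [phi z0] are to be found. *)
Let r1 : R := (1 + modulus z0) / 2.
Let r2 : R := (modulus z0 + r1) / 2.
Let radii : [/\ 0 <= modulus z0, modulus z0 < r2, r2 < r1 & r1 < 1].
Proof. by have := z01; have := modulus_ge0 z0; rewrite /r2 /r1; split; lra. Qed.

Let q_bounded : exists2 M : R, 0 < M & forall w, modulus w <= r1 ->
  modulus (q w) <= M /\ (modulus (q w))^-1 <= M.
Proof.
have [z00 z0r2 r21 r11] := radii; have r10 : 0 <= r1 by lra.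
have [M M0 MP] := @continuous_modulus_bounded R q r1 r10
  (fun w wr => q_hol.1 _ (le_lt_trans wr r11)).
have Vq : holomorphic_off 1 [:: z0] (fun w => (q w)^-1).
  by apply: holomorphic_offV; [exact: q_neq0|exact: q_hol].
have [M' M'0 MP'] := @continuous_modulus_bounded R _ r1 r10
  (fun w wr => Vq.1 _ (le_lt_trans wr r11)).
exists (M + M') => [|w wr]; first exact: addr_gt0.
have := MP _ wr; have := MP' _ wr; rewrite modulusV; split; lra.
Qed.

(* Every value close to [phi z0] is taken inside the circle of radius [r1]
   (Cauchy estimate for [1 / (phi - a)] at [z0]), hence not outside. *)
Let phi_away : exists2 d : R, 0 < d & forall w, modulus w < 1 -> r1 <= modulus w ->
  d <= modulus (phi w - phi z0).
Proof.
have [z00 z0r2 r21 r11] := radii; have [M M0 MP] := q_bounded.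
(* On the circle of radius [r2], [phi - phi z0] is [q], of modulus at least [1 / M], times [w - z0],
   of modulus at least [r2 - modulus z0]. *)
pose m := (r2 - modulus z0) / M; have m0 : 0 < m by rewrite divr_gt0//; lra.
have mP w : modulus w = r2 -> m <= modulus (phi w - phi z0).
  move=> wr; rewrite qE addrC addKr modulusM /m mulrC; apply: ler_pM.
  - by rewrite invr_ge0 ltW.
  - lra.
  - have [_ H] := MP w ltac:(lra); have qp : 0 < modulus (q w).
      by rewrite modulus_gt0; apply: q_neq0; lra.
    by rewrite -[leRHS]invrK lef_pV2 ?posrE// invr_gt0.
  - have := modulusD (w - z0) z0; rewrite subrK wr; lra.
(* If [phi w] is not taken inside, [1 / (phi - phi w)] is at most [2 / m] on the circle, and the
   Cauchy estimate then forces [phi z0 - phi w] to have modulus at least [k]. *)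
clearbody m; pose k := m * (r2 - modulus z0) / (2 * r2).
have r20 : 0 < r2 by lra.
have k0 : 0 < k by rewrite divr_gt0// mulr_gt0// subr_gt0.
pose d := Num.min (m / 2) k.
have d0 : 0 < d by rewrite lt_min k0 divr_gt0.
exists (d / 2) => [|w w1 rw]; first by rewrite divr_gt0.
rewrite leNgt; apply/negP => wd.
suff [x xr /(phi_inj _ w1) xw] : exists2 x, modulus x < r1 & phi x = phi w.
  have x1 : modulus x < 1 by lra.
  by move: xr; rewrite (xw x1) ltNge rw.
apply: contrapT => nx.
have nz x : modulus x < r1 -> phi x - phi w != 0.
  by move=> xr; rewrite subr_eq0; apply/eqP => xw; apply: nx; exists x.
have hinv : holomorphic_off r1 [::] (fun x => (phi x - phi w)^-1).
  apply: holomorphic_offV; first exact: nz.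
  apply: holomorphic_offB; last exact: holomorphic_off_cst.
  by apply: holomorphic_offW (phi_hol [::]); [lra|].
have := @cauchy_estimate _ _ _ _ z0 r2 hinv isT z0r2 r21.
have p0 := two_pi_gt0 (R := R).
set I := segment_integral _ _ _; have Ile : I <= 2 / m * (2 * pi).
  rewrite -[leRHS]/(2 / m * (2 * pi)) -[X in _ * X]subr0.
  rewrite -(segment_integral_cst _ (ltW p0)); apply: segment_integral_le.
  - apply: (@continuous_between_circle_modulus _ (fun x => (phi x - phi w)^-1)).
    by move=> x xr; apply: hinv.1; rewrite xr ger0_norm// ltW.
  - exact: continuous_between_cst.
  - move=> t _; rewrite modulusV.
    have pr : modulus (r2%:C * cis t) = r2 by rewrite modulus_polar ger0_norm// ltW.
    have -> : 2 / m = (m / 2)^-1 by rewrite invfM invrK mulrC.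
    have dm : d <= m / 2 by rewrite ge_min lexx.
    have := mP _ pr; have := modulusD (phi (r2%:C * cis t) - phi w) (phi w - phi z0).
    rewrite addrA subrK => A B.
    rewrite lef_pV2 ?posrE ?divr_gt0//; first lra.
    by rewrite modulus_gt0; apply: nz; rewrite pr.
move=> CE.
have zw : 0 < modulus (phi z0 - phi w) by rewrite modulus_gt0 nz//; lra.
have : (r2 - modulus z0) * (modulus (phi z0 - phi w)^-1 * (2 * pi)) <=
    r2 * (2 / m * (2 * pi)).
  by rewrite (le_trans CE)// ler_pM2l.
rewrite !mulrA ler_pM2r ?pi_gt0// ler_pM2r// modulusV ler_pdivrMr// => H.
have kd : d <= k by rewrite ge_min lexx orbT.
have kz : k <= modulus (phi z0 - phi w).
  rewrite /k ler_pdivrMr; last exact: mulr_gt0.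
  have : (r2 - modulus z0) * m <= r2 * 2 * modulus (phi z0 - phi w).
    by move: H; rewrite mulrAC ler_pdivlMr.
  by lra.
by move: wd; rewrite modulusB; lra.
Qed.

(** The quotient of the two involutions with the factor [w - z0] cancelled by means of [q]: it makes
    sense at [z0], where it inherits the continuity of [q]. *)
Let S w : R[i]^o := q w * ((1 - conjc z0 * w) * (1 - conjc (phi z0) * phi w)^-1).

Let den_phi w : modulus w < 1 -> 1 - conjc (phi z0) * phi w != 0.
Proof.
by move=> w1; apply: moebius_den; [exact: phi_disk|exact/ltW/phi_disk].
Qed.

Let S_hol : holomorphic_off 1 [:: z0] S.
Proof.
apply: holomorphic_offM; first exact: q_hol.
apply: holomorphic_offM.
  apply: holomorphic_offB; first exact: holomorphic_off_cst.
  apply: holomorphic_offM; first exact: holomorphic_off_cst.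
  exact: holomorphic_off_id.
apply: holomorphic_offV; first exact: den_phi.
apply: holomorphic_offB; first exact: holomorphic_off_cst.
apply: holomorphic_offM; first exact: holomorphic_off_cst.
exact: phi_hol.
Qed.

Let S_neq0 w : modulus w < 1 -> S w != 0.
Proof.
move=> w1; rewrite mulf_neq0 ?q_neq0// mulf_neq0 ?invr_eq0 ?den_phi//.
by apply: moebius_den => //; exact: ltW.
Qed.

Let SE w : modulus w < 1 -> moebius (phi z0) (phi w) = S w * moebius z0 w.
Proof.
move=> w1; have d1 := den_phi w1; have d2 := moebius_den z01 (ltW w1).
rewrite /moebius /S; have -> : phi z0 - phi w = - (q w * (w - z0)).
  by rewrite [phi w]qE opprD addrA subrr add0r.
move: d1 d2; set x := 1 - conjc (phi z0) * _; set y := 1 - _ => d1 d2.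
by field; rewrite d1 d2.
Qed.

Let one_sub_bounds a w : modulus a < 1 -> modulus w < 1 ->
  1 - modulus a <= modulus (1 - conjc a * w) <= 2.
Proof.
move=> a1 w1; have aw : modulus (conjc a * w) <= modulus a.
  by rewrite modulusM modulusJ ler_piMr ?modulus_ge0// ltW.
have := modulusD (1 - conjc a * w) (conjc a * w); rewrite subrK modulus1.
have := modulusD 1 (- (conjc a * w)); rewrite modulusN modulus1; lra.
Qed.

(** Compactness gives the bounds up to radius [r1]. Beyond it [q] is the quotient of
    [phi w - phi z0] by [w - z0], both at most 2 in modulus and bounded below, the former by
    [phi_away]. *)
Let q_bounded_disk : exists2 M : R, 0 < M & forall w, modulus w < 1 ->
  modulus (q w) <= M /\ (modulus (q w))^-1 <= M.
Proof.
have [z00 z0r2 r21 r11] := radii; have [M M0 MP] := q_bounded.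
have [d d0 dP] := phi_away; have rz : 0 < r1 - modulus z0 by lra.
exists (M + 2 / (r1 - modulus z0) + 2 / d).
  by rewrite !addr_gt0 ?divr_gt0.
have X1 : 0 < 2 / (r1 - modulus z0) by rewrite divr_gt0.
have X2 : 0 < 2 / d by rewrite divr_gt0.
move=> w w1; have [wr|rw] := leP (modulus w) r1.
  by have := MP _ wr; split; lra.
have wz : r1 - modulus z0 <= modulus (w - z0).
  by have := modulusD (w - z0) z0; rewrite subrK; lra.
have wz2 : modulus (w - z0) <= 2.
  by rewrite (le_trans (modulusD _ _))// modulusN; lra.
have pw := dP _ w1 (ltW rw).
have pw2 : modulus (phi w - phi z0) <= 2.
  rewrite (le_trans (modulusD _ _))// modulusN.
  by have := phi_disk w1; have := phi_disk z01; lra.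
have qw : modulus (q w) * modulus (w - z0) = modulus (phi w - phi z0).
  by rewrite -modulusM [phi w]qE [_ + q w * _]addrC addrK.
have q0 : 0 < modulus (q w) by rewrite modulus_gt0 q_neq0.
have Y1 : modulus (q w) <= 2 / (r1 - modulus z0).
  rewrite ler_pdivlMr// (le_trans _ pw2)// -qw ler_wpM2l ?modulus_ge0//.
have Y2 : (modulus (q w))^-1 <= 2 / d.
  rewrite ler_pdivlMr// mulrC ler_pdivrMr// (le_trans pw)// -qw mulrC.
  by rewrite ler_wpM2r ?modulus_ge0.
by split; lra.
Qed.

Let S_bounded : exists M : R, forall w, modulus w < 1 ->
  modulus (S w) <= M /\ modulus (S w)^-1 <= M.
Proof.
have [M M0 MP] := q_bounded_disk.
have p1 := phi_disk z01.
pose A := (1 - modulus z0)^-1 + (1 - modulus (phi z0))^-1.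
exists (M * (2 * A)) => w w1.
have [B1 B2] := andP (one_sub_bounds z01 w1).
have [C1 C2] := andP (one_sub_bounds p1 (phi_disk w1)).
have [Q1 Q2] := MP _ w1.
have iz : 0 < (1 - modulus z0)^-1 by rewrite invr_gt0 subr_gt0.
have ip : 0 < (1 - modulus (phi z0))^-1 by rewrite invr_gt0 subr_gt0.
have B3 : (modulus (1 - conjc z0 * w))^-1 <= A.
  apply: (@le_trans _ _ (1 - modulus z0)^-1); last by rewrite lerDl ltW.
  by rewrite lef_pV2 ?posrE ?subr_gt0// (lt_le_trans _ B1)// subr_gt0.
have C3 : (modulus (1 - conjc (phi z0) * phi w))^-1 <= A.
  apply: (@le_trans _ _ (1 - modulus (phi z0))^-1); last by rewrite lerDr ltW.
  by rewrite lef_pV2 ?posrE ?subr_gt0// (lt_le_trans _ C1)// subr_gt0.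
rewrite /S modulusV !modulusM modulusV; split.
  apply: ler_pM; rewrite ?mulr_ge0 ?invr_ge0 ?modulus_ge0//.
  by apply: ler_pM; rewrite ?invr_ge0 ?modulus_ge0.
rewrite !invfM invrK; apply: ler_pM; rewrite ?mulr_ge0 ?invr_ge0 ?modulus_ge0//.
by rewrite mulrC; apply: ler_pM; rewrite ?invr_ge0 ?modulus_ge0.
Qed.

Let S_radial : \forall t \ae (@lebesgue_measure R), t \in `[0, 2 * pi] ->
  modulus (S (r%:C * cis t)) @[r --> (1 : R)^'-] --> (1 : R).
Proof.
have p1 := phi_disk z01.
case: phi_inner => _ _; apply: lebesgue_ae_imply => t tl tI.
have [l hl /eqP] := tl tI; rewrite normcE (inj_eq (@complexI _)) => /eqP l1.
have cl : {for l, continuous (moebius (phi z0))}.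
  by apply: derivable_continuousC; apply: moebius_derivable; rewrite ?l1.
have H1 : (fun r : R => moebius (phi z0) (phi (r%:C * cis t))) @ (1 : R)^'- -->
    moebius (phi z0) l by exact: (cvg_comp _ _ hl cl).
have {}H1 : (fun r : R => modulus (moebius (phi z0) (phi (r%:C * cis t)))) @
    (1 : R)^'- --> (1 : R).
  suff : (fun r : R => modulus (moebius (phi z0) (phi (r%:C * cis t)))) @
      (1 : R)^'- --> modulus (moebius (phi z0) l) by rewrite moebius_circle.
  exact: (@cvg_modulus R _ _ _ (fun r : R => moebius (phi z0) _) _ H1).
have c1 : modulus (1%:C * cis t) = 1 :> R by rewrite modulus_polar normr1.
have cz : {for 1%:C * cis t, continuous (moebius z0)}.
  by apply: derivable_continuousC; apply: moebius_derivable; rewrite ?c1.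
have H2 : (fun r : R => moebius z0 (r%:C * cis t)) @ (1 : R)^'- -->
    moebius z0 (1%:C * cis t).
  have [_ H] := continuous_polar cz; exact: cvg_at_left_filter H.
have {}H2 : (fun r : R => modulus (moebius z0 (r%:C * cis t))) @ (1 : R)^'- -->
    (1 : R).
  suff : (fun r : R => modulus (moebius z0 (r%:C * cis t))) @
      (1 : R)^'- --> modulus (moebius z0 (1%:C * cis t)) by rewrite moebius_circle.
  exact: (@cvg_modulus R _ _ _ (fun r : R => moebius z0 _) _ H2).
have H3 : (fun r : R => modulus (moebius (phi z0) (phi (r%:C * cis t))) /
    modulus (moebius z0 (r%:C * cis t))) @ (1 : R)^'- --> (1 / 1 : R).
  by apply: cvgM => //; apply: cvgV => //; exact: oner_neq0.
rewrite divr1 in H3; apply: cvg_trans H3; apply: near_eq_cvg.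
(* Beyond radius [modulus z0] the denominator [moebius z0] has no zero, so the quotient of moduli is
   that of [S]. *)
near=> r.
have rz : modulus z0 < r by near: r; exact: nbhs_left_gt.
have r1' : r < 1 by near: r; exact: nbhs_left_lt.
have z00 := modulus_ge0 z0.
have pr : modulus (r%:C * cis t) = r by rewrite modulus_polar ger0_norm; lra.
have w1 : modulus (r%:C * cis t) < 1 by rewrite pr.
rewrite (SE w1) modulusM mulfK// modulus_eq0; apply/eqP.
move=> /(moebius_eq0 z01 (ltW w1)) wz; move: rz; rewrite -wz pr ltxx.
Unshelve. all: by end_near. Qed.

Let S_unimodular w : modulus w < 1 -> modulus (S w) = 1.
Proof.
have [M MP] := S_bounded.
suff main x : modulus x < 1 -> x != z0 -> modulus (S x) = 1.
  move=> w1; have [->|wz] := eqVneq w z0; last exact: main.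
  by apply: (continuous_constant_modulus (S_hol.1 _ z01)).
move=> x1 xz; have xE : x \notin [:: z0] by rewrite inE.
apply/eqP; rewrite eq_le; apply/andP; split.
  have b1 y : modulus y < 1 -> modulus (S y) <= M by move=> /MP[].
  exact: (boundary_maximum S_hol b1 S_radial x1 xE).
have VS : holomorphic_off 1 [:: z0] (fun w => (S w)^-1).
  by apply: holomorphic_offV; [exact: S_neq0|exact: S_hol].
have rV : \forall t \ae (@lebesgue_measure R), t \in `[0, 2 * pi] ->
    modulus (S (r%:C * cis t))^-1 @[r --> (1 : R)^'-] --> (1 : R).
  move: S_radial; apply: lebesgue_ae_imply => t H tI; have {}H := H tI.
  have -> : (fun r : R => modulus (S (r%:C * cis t))^-1) =
      (fun r : R => (modulus (S (r%:C * cis t)))^-1).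
    by apply/funext => r; rewrite modulusV.
  suff : (fun r : R => (modulus (S (r%:C * cis t)))^-1) @ (1 : R)^'- -->
      (1^-1 : R) by rewrite invr1.
  by apply: cvgV => //; exact: oner_neq0.
have b2 y : modulus y < 1 -> modulus (S y)^-1 <= M by move=> /MP[].
have := boundary_maximum VS b2 rV x1 xE; rewrite modulusV.
by rewrite invf_le1 ?modulus_gt0 ?S_neq0.
Qed.

Lemma rigid_automorphism : disk_automorphism phi.
Proof.
have p1 := phi_disk z01; pose c := S 0.
have c1 : modulus c = 1 by apply: S_unimodular; rewrite modulus0.
have Sc w : modulus w < 1 -> S w = c.
  apply: (center_maximum S_hol) => // x x1.
  by rewrite S_unimodular.
have cc : conjc c * c = 1 by rewrite mul_conj_modulus c1 expr1n.
have cc' : c * conjc c = 1 by rewrite mulrC.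
have phiE w : modulus w < 1 -> moebius (phi z0) (phi w) = c * moebius z0 w.
  by move=> w1; rewrite SE// Sc.
have holM a w : modulus a < 1 -> modulus w < 1 -> derivable (moebius a) w 1.
  by move=> a1 w1; apply: moebius_derivable => //; exact: ltW.
have rot w : modulus w < 1 -> modulus (conjc c * w) < 1.
  by move=> w1; rewrite modulusM modulusJ c1 mul1r.
have rot' w : modulus w < 1 -> modulus (c * w) < 1.
  by move=> w1; rewrite modulusM c1 mul1r.
pose rotc : R[i]^o -> R[i]^o := fun w => conjc c * w.
split.
- by case: phi_inner.
- by move=> w; rewrite /= !diskE; exact: phi_disk.
(* Obtained by solving [phiE] for [w]: both involutions are their own inverses, and the inverse of
   the rotation by [c] is the one by its conjugate. *)
exists (moebius z0 \o (rotc \o moebius (phi z0))); split.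
- move=> w; rewrite diskE => w1; have m1 := moebius_disk p1 w1.
  apply: derivable_compC; last exact: holM (rot _ m1).
  apply: derivable_compC; first exact: holM.
  apply: (@derivableM_num R[i]); first exact: (@derivable_cst_num R[i]).
  exact: (@derivable_id_num R[i]).
- move=> w; rewrite /= !diskE => w1.
  exact: moebius_disk z01 (rot _ (moebius_disk p1 w1)).
- move=> w; rewrite inE diskE => w1 /=.
  by rewrite /rotc phiE// mulrA cc mul1r moebiusK.
- move=> w; rewrite inE diskE => w1 /=.
  set x := moebius z0 _.
  have b1 := moebius_disk p1 w1; have x1 : modulus x < 1.
    exact: moebius_disk z01 (rot _ b1).
  rewrite -(moebiusK p1 (phi_disk x1)) phiE// /x moebiusK//; last exact: rot.
  by rewrite /rotc mulrA cc' mul1r moebiusK.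
Qed.

End Rigidity.

(** If [phi] were not an automorphism, [rigid_automorphism] would exclude every point with a nonzero
    derivative, and [phi] would be constant. *)
Theorem injective_inner_automorphism phi : inner phi -> ~ constant_on_disk phi ->
  (forall z w, modulus z < 1 -> modulus w < 1 -> phi z = phi w -> z = w) ->
  disk_automorphism phi.
Proof.
move=> hphi nphi inj; have dphi := inner_nonconstant hphi nphi.
have hol : holomorphic_off 1 [::] phi by case: hphi => h _ _; exact: holomorphicW.
have dz z : modulus z < 1 -> derivable phi z 1.
  by case: hphi => h _ _ z1; apply: h; rewrite diskE.
apply: contrapT => na; apply: nphi; exists (phi 0) => z; rewrite inE diskE.
apply: zero_derivative_constant => {}z z1 e e0.
have [l [q [hq qE ql lP]]] := difference_quotient hol z1 (dz z z1).
have [l0|ln] := eqVneq l 0; last first.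
  exfalso; apply: na; apply: (rigid_automorphism hphi dphi inj z1 hq qE).
  by rewrite ql.
by have [d d0 D] := lP e e0; exists d => // w /D; rewrite l0 mul0r subr0.
Qed.

End InjectiveInner.

(** * Jensen's inequality without zeros *)

Section Jensen.
Context {R : realType}.
Implicit Types (f : R[i]^o -> R[i]^o) (z w : R[i]^o) (r s : R).

(** The Cauchy estimate for the difference quotient of [f] at [w], on the circle of radius [p]
    halfway between [r] and 1. There the quotient is at most [2 / (p - r)], and the estimate costs
    another factor [p / (p - r)]. *)
Lemma holomorphic_lipschitz f r : holomorphic_off 1 [::] f ->
  (forall z, modulus z < 1 -> modulus (f z) <= 1) -> 0 <= r < 1 ->
  exists2 L : R, 0 < L & forall z w, modulus z <= r -> modulus w <= r ->
    modulus (f z - f w) <= L * modulus (z - w).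
Proof.
move=> hf f1 /andP[r0 r1]; pose p := (r + 1) / 2.
have [rp p1] : r < p /\ p < 1 by rewrite /p; lra.
have pr0 : 0 < p - r by lra. have p0 : 0 < p by lra.
have tp := two_pi_gt0 (R := R).
exists (2 * p / (p - r) ^+ 2) => [|z w zr wr].
  by rewrite divr_gt0 ?exprn_gt0// mulr_gt0.
have [->|zw] := eqVneq z w; first by rewrite !subrr modulus0 mulr0.
have w1 : modulus w < 1 by lra.
have dw : derivable f w 1 by apply: hf.2 => //.
have [l [q [hq fE _ _]]] := difference_quotient hf w1 dw.
have zE : z \notin [:: w] by rewrite inE.
have := @cauchy_estimate _ _ _ _ z p hq zE ltac:(lra) p1.
set I := segment_integral _ _ _; have Ile : I <= 2 / (p - r) * (2 * pi).
  rewrite -[X in _ * X]subr0.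
  rewrite -(segment_integral_cst _ (ltW tp)); apply: segment_integral_le.
  - apply: (@continuous_between_circle_modulus _ q).
    by move=> x xr; apply: hq.1; rewrite xr ger0_norm// ltW.
  - exact: continuous_between_cst.
  - move=> t _; set x := _ * cis t.
    have xp : modulus x = p by rewrite modulus_polar ger0_norm// ltW.
    clearbody x; have xw : p - r <= modulus (x - w).
      by have := modulusD (x - w) w; rewrite subrK; lra.
    rewrite ler_pdivlMr//; apply: (@le_trans _ _ (modulus (q x) * modulus (x - w))).
      by rewrite ler_wpM2l ?modulus_ge0.
    rewrite -modulusM; have -> : q x * (x - w) = f x - f w.
      by rewrite [f x]fE addrAC subrr add0r.
    rewrite (le_trans (modulusD _ _))// modulusN.
    have := f1 _ w1; have := f1 x ltac:(lra); lra.
move=> CE.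
have -> : f z - f w = q z * (z - w) by rewrite [f z]fE addrAC subrr add0r.
rewrite modulusM ler_wpM2r ?modulus_ge0// ler_pdivlMr ?exprn_gt0//.
have q0 := modulus_ge0 (q z).
have H1 : (p - r) * (modulus (q z) * (2 * pi)) <= p * (2 / (p - r) * (2 * pi)).
  apply: (@le_trans _ _ ((p - modulus z) * (modulus (q z) * (2 * pi)))).
    by rewrite ler_wpM2r// ?mulr_ge0// ?(ltW tp)//; lra.
  by rewrite (le_trans CE)// ler_pM2l.
have H2 : (p - r) * modulus (q z) <= p * (2 / (p - r)).
  by rewrite -(ler_pM2r tp) -!mulrA; move: H1; rewrite !mulrA.
have H3 : (p - r) * modulus (q z) * (p - r) <= 2 * p.
  rewrite -ler_pdivlMr//; apply: (le_trans H2).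
  by rewrite mulrA [p * 2]mulrC.
by move: H3; rewrite expr2 mulrAC mulrC mulrA.
Qed.

(** Half of [ln x <= x - 1] at the squared modulus. It replaces the logarithm by a real part, whose
    circle means are known, up to a quadratic error. *)
Lemma ln_modulus_le z : z != 0 ->
  ln (modulus z) <= complex.Re (z - 1) + modulus (z - 1) ^+ 2 / 2.
Proof.
move=> z0; have m0 : 0 < modulus z by rewrite modulus_gt0.
have L2 : ln (modulus z ^+ 2) = 2 * ln (modulus z).
  by rewrite lnXn// mulr_natl.
have := @le_ln1Dx R (modulus z ^+ 2 - 1).
have m2 : 0 < modulus z ^+ 2 by rewrite exprn_gt0.
rewrite addrCA subrr addr0 L2 => /(_ ltac:(lra)).
rewrite !modulus_sqr; case: z {z0 m0 L2 m2} => x y /=.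
rewrite oppr0 addr0 !expr2; lra.
Qed.

Lemma continuous_between_ln_modulus f r a b :
  (forall z, modulus z = `|r| -> {for z, continuous f}) ->
  (forall z, modulus z = `|r| -> f z != 0) ->
  continuous_between a b (fun t => ln (modulus (f (r%:C * cis t)))).
Proof.
move=> cf f0 t tI.
have c := @continuous_between_circle_modulus _ f r a b cf t tI.
have p0 : 0 < modulus (f (r%:C * cis t)).
  by rewrite modulus_gt0 f0// modulus_polar.
exact: (cvg_comp _ _ c (continuous_ln p0)).
Qed.

Variables (f : R[i]^o -> R[i]^o) (r : R).
Hypotheses (hf : holomorphic_off 1 [::] f)
  (f1 : forall z, modulus z < 1 -> modulus (f z) <= 1)
  (f0 : forall z, modulus z < 1 -> f z != 0) (r01 : 0 < r < 1).

Let m s := segment_integral 0 (2 * pi) (fun t => ln (modulus (f (s%:C * cis t)))).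

Let continuous_ln_modulus s : 0 <= s <= r ->
  continuous_between 0 (2 * pi) (fun t => ln (modulus (f (s%:C * cis t)))).
Proof.
have := r01 => r01' sr; apply: continuous_between_ln_modulus => z zs.
  by apply: hf.1; rewrite zs ger0_norm; lra.
by apply: f0; rewrite zs ger0_norm; lra.
Qed.

(** The quotient [Q] of [f (s' z)] by [f (s z)] is holomorphic for [modulus z < 1 / r], hence across
    the unit circle, and [Q 0 = 1]. So the real part of [Q - 1] has mean 0, and [ln_modulus_le]
    leaves half the mean of [|Q - 1| ^ 2], where [|Q - 1|] is at most [L * B * |s' - s|]. *)
Let step : exists2 K : R, 0 < K & forall s s', 0 <= s <= r -> 0 <= s' <= r ->
  m s' - m s <= K * (s' - s) ^+ 2.
Proof.
have := r01 => r01'; have r01'' : 0 <= r < 1 by lra.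
have [L L0 LP] := holomorphic_lipschitz hf f1 r01''.
have Vf : holomorphic_off 1 [::] (fun w => (f w)^-1).
  by apply: holomorphic_offV; [exact: f0|exact: hf].
have r0 : 0 <= r by lra. have r1 : r < 1 by lra.
have [B B0 BP] := @continuous_modulus_bounded R _ r r0
  (fun w wr => Vf.1 _ (le_lt_trans wr r1)).
have tp := two_pi_gt0 (R := R).
exists ((L * B) ^+ 2 / 2 * (2 * pi)).
  by rewrite mulr_gt0// divr_gt0// exprn_gt0// mulr_gt0.
move=> s s' sr sr'.
pose Q z := f (s'%:C * z) * (f (s%:C * z))^-1.
have scale x z : 0 <= x <= r -> modulus z < r^-1 -> modulus (x%:C * z) < 1.
  move=> /andP[x0 xr] zr; rewrite modulusM modulusC ger0_norm//.
  apply: (@le_lt_trans _ _ (r * modulus z)); first by rewrite ler_wpM2r// modulus_ge0.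
  by rewrite -ltr_pdivlMl ?mulr1//; lra.
have hs x : 0 <= x <= r -> holomorphic_off r^-1 [::] (fun z => f (x%:C * z)).
  move=> xr; apply: holomorphic_off_derivable => z zr.
  apply: (@derivable_compC _ (fun z => x%:C * z) f).
    apply: (@derivableM_num R[i]); first exact: (@derivable_cst_num R[i]).
    exact: (@derivable_id_num R[i]).
  by apply: hf.2 => //; exact: scale.
have hQ : holomorphic_off r^-1 [::] Q.
  apply: holomorphic_offM; first exact: hs.
  by apply: holomorphic_offV; [move=> z zr; apply/f0/scale|exact: hs].
have r1V : 1 < r^-1 by rewrite invf_gt1//; lra.
have M1 := @mean_value _ _ _ _ 1 hQ; rewrite ler01 r1V in M1.
have Q0 : Q 0 = 1 by rewrite /Q !mulr0 divff// f0// modulus0.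
have {}M1 : circle_integral Q 1 = 2 * pi by rewrite M1// Q0 mul1r.
pose e := (L * B * `|s' - s|) ^+ 2 / 2.
have -> : (L * B) ^+ 2 / 2 * (2 * pi) * (s' - s) ^+ 2 = (e - 1) * (2 * pi - 0) + 2 * pi.
  by rewrite /e [(L * B * _) ^+ 2]exprMn real_normK ?num_real//; ring.
rewrite -(segment_integral_cst _ (ltW tp)) -[X in _ <= _ + X]M1 circle_integralE.
rewrite /m -segment_integralB; [|exact: continuous_ln_modulus..].
have cQ : continuous_between 0 (2 * pi) (fun t => complex.Re (Q (1%:C * cis t))).
  by apply: continuous_between_circle => z z1; apply: hQ.1; rewrite z1 normr1.
rewrite -segment_integralD; [|exact: continuous_between_cst|exact: cQ].
apply: segment_integral_le => [t tI|t tI|t tI].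
- by apply: cvgB; exact: continuous_ln_modulus.
- by apply: cvgD; [exact: cvg_cst|exact: cQ].
rewrite /= mul1r; set c := cis t.
have c1 : modulus c = 1 by exact: modulus_cis.
have [n0 n0'] : f (s%:C * c) != 0 /\ f (s'%:C * c) != 0.
  by split; apply: f0; rewrite modulus_polar ger0_norm; lra.
have QE : modulus (f (s'%:C * c)) / modulus (f (s%:C * c)) = modulus (Q c).
  by rewrite /Q modulusM modulusV.
rewrite -ln_div ?posrE ?modulus_gt0// QE.
have Qn : Q c != 0 by rewrite mulf_neq0// invr_neq0.
apply: (le_trans (ln_modulus_le Qn)); rewrite raddfB /=.
suff : modulus (Q c - 1) ^+ 2 / 2 <= e by lra.
rewrite ler_pM2r// lerXn2r ?nnegrE ?modulus_ge0//.
  by rewrite !mulr_ge0// ltW.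
have -> : Q c - 1 = (f (s'%:C * c) - f (s%:C * c)) * (f (s%:C * c))^-1.
  by rewrite mulrBl divff.
rewrite modulusM mulrAC; apply: ler_pM; rewrite ?modulus_ge0//; last first.
  by apply: BP; rewrite modulus_polar ger0_norm; lra.
have := LP (s'%:C * c) (s%:C * c); rewrite -mulrBl -rmorphB !modulus_polar.
by apply; rewrite ger0_norm; lra.
Qed.

(** With [n + 1] equal steps from radius 0 to [r], the quadratic errors add up to
    [K * r ^ 2 / (n + 1)], which tends to 0. *)
Lemma jensen_zero_free : m r <= ln (modulus (f 0)) * (2 * pi).
Proof.
have tp := two_pi_gt0 (R := R); have [K K0 KP] := step.
have := r01 => /andP[r0 r1].
have m0 : m 0 = ln (modulus (f 0)) * (2 * pi).
  rewrite /m; under eq_fun do rewrite mul0r.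
  by rewrite segment_integral_cst ?subr0// ltW.
rewrite -m0.
have tele (n : nat) (k : nat) : (k <= n.+1)%N ->
    m (r / n.+1%:R * k%:R) <= m 0 + k%:R * (K * (r / n.+1%:R) ^+ 2).
  elim: k => [|k IH] kn; first by rewrite mulr0 mul0r addr0.
  have bnd j : (j <= n.+1)%N -> 0 <= r / n.+1%:R * j%:R <= r.
    move=> jn; rewrite !mulr_ge0 ?invr_ge0 ?ler0n ?(ltW r0)//=.
    by rewrite -mulrA ler_piMr ?(ltW r0)// mulrC ler_pdivrMr ?ltr0n// mul1r ler_nat.
  have := KP _ _ (bnd _ (ltnW kn)) (bnd _ kn); have := IH (ltnW kn).
  have -> : r / n.+1%:R * k.+1%:R - r / n.+1%:R * k%:R = r / n.+1%:R.
    by rewrite -mulrBr -natrB// subSn// subnn mulr1.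
  set X := K * _; have -> : k.+1%:R * X = k%:R * X + X.
    by rewrite -addn1 natrD mulrDl mul1r.
  by move=> A B; rewrite addrA (le_trans _ (lerD A (lexx X)))// -lerBlDl.
have bound n : m r - m 0 <= K * r ^+ 2 * n.+1%:R^-1.
  have := tele n n.+1 (leqnn _).
  have n0 : n.+1%:R != 0 :> R by rewrite pnatr_eq0.
  rewrite divfK//.
  have -> : n.+1%:R * (K * (r / n.+1%:R) ^+ 2) = K * r ^+ 2 * n.+1%:R^-1 by field.
  by rewrite lerBlDl.
rewrite -subr_le0.
have cv : (fun n => K * r ^+ 2 * n.+1%:R^-1) @ \oo --> (0 : R).
  rewrite -(mulr0 (K * r ^+ 2)); apply: cvgM; first exact: cvg_cst.
  exact: (@cvg_harmonic R).
rewrite leNgt; apply/negP => pos.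
have /cvgr_lt/(_ _ pos)[n _ /(_ n (leqnn n)) /=] := cv.
by rewrite ltNge bound.
Qed.

End Jensen.

(** * Poisson integrals *)

Section PoissonKernel.
Context {R : realType}.
Implicit Types (f F : R[i]^o -> R[i]^o) (z : R[i]^o) (t r : R).
Local Notation mu := (@lebesgue_measure R).

(** Not normalized: the total mass over the circle is [2 * pi]. *)
Definition poisson_kernel t z : R := complex.Re ((cis t + z) / (cis t - z)).

Lemma cis_sub_neq0 t z : modulus z < 1 -> cis t - z != 0.
Proof. by move=> z1; have := polar_sub_neq0 t z1; rewrite rmorph1 mul1r. Qed.

Lemma poisson_kernelE t z :
  poisson_kernel t z = (1 - modulus z ^+ 2) / modulus (cis t - z) ^+ 2.
Proof.
rewrite /poisson_kernel invc_norm normcE -rmorphXn -fmorphV mulrCA RemulC mulrC.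
congr (_ * _); rewrite modulus_sqr; case: z => x y /=.
have := cos2Dsin2 t; rewrite !expr2; lra.
Qed.

Lemma poisson_kernel_ge0 t z : modulus z < 1 -> 0 <= poisson_kernel t z.
Proof.
move=> z1; rewrite poisson_kernelE divr_ge0 ?exprn_ge0 ?modulus_ge0//.
by rewrite subr_ge0 expr_le1 ?modulus_ge0// ltW.
Qed.

Lemma poisson_kernel_le t z : modulus z < 1 ->
  poisson_kernel t z <= 2 / (1 - modulus z).
Proof.
move=> z1; rewrite (le_trans (ler_norm _))// (le_trans (ler_Re_modulus _))//.
have c1 := @modulus_cis R t; have z10 : 0 < 1 - modulus z by rewrite subr_gt0.
rewrite modulusM modulusV; apply: ler_pM; rewrite ?invr_ge0 ?modulus_ge0//.
  by rewrite (le_trans (modulusD _ _))// c1; lra.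
rewrite lef_pV2 ?posrE ?modulus_gt0 ?cis_sub_neq0//.
by have := modulusD (cis t - z) z; rewrite subrK c1; lra.
Qed.

Lemma holomorphic_herglotz F t : holomorphic_off 1 [::] F ->
  (forall z, modulus z < 1 -> modulus (F z) < 1) ->
  holomorphic_off 1 [::] (fun z => (cis t + F z) / (cis t - F z)).
Proof.
move=> hF F1; apply: holomorphic_offM.
  have -> : (fun z => cis t + F z) = (fun z => cis t - (0 - F z)).
    by apply/funext => z; rewrite sub0r opprK.
  apply: holomorphic_offB; first exact: holomorphic_off_cst.
  by apply: holomorphic_offB; [exact: holomorphic_off_cst|exact: hF].
apply: holomorphic_offV; first by move=> z z1; apply/cis_sub_neq0/F1.
by apply: holomorphic_offB; [exact: holomorphic_off_cst|exact: hF].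
Qed.

Lemma continuous_poisson_kernel_comp F t r a b : holomorphic_off 1 [::] F ->
  (forall z, modulus z < 1 -> modulus (F z) < 1) -> 0 <= r < 1 ->
  continuous_between a b (fun x => poisson_kernel t (F (r%:C * cis x))).
Proof.
move=> hF F1 r1; have hol := holomorphic_herglotz t hF F1.
apply: (continuous_between_circle (f := fun z => (cis t + F z) / (cis t - F z))).
by move=> z zr; apply: hol.1; rewrite zr ger0_norm; lra.
Qed.

Lemma poisson_kernel_mean F t r : holomorphic_off 1 [::] F ->
  (forall z, modulus z < 1 -> modulus (F z) < 1) -> 0 <= r < 1 ->
  segment_integral 0 (2 * pi) (fun x => poisson_kernel t (F (r%:C * cis x))) =
  poisson_kernel t (F 0) * (2 * pi).
Proof.
by move=> hF F1 r1; rewrite -(mean_value (holomorphic_herglotz t hF F1) r1).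
Qed.

Lemma continuous_poisson_kernel z a b : modulus z < 1 ->
  continuous_between a b (poisson_kernel ^~ z).
Proof.
move=> z1.
have -> : poisson_kernel ^~ z = fun t => complex.Re
    ((fun w : R[i]^o => (w + z) * (w - z)^-1) (1%:C * cis t)).
  by apply/funext => t; rewrite rmorph1 mul1r.
apply: (@continuous_between_circle _ (fun w : R[i]^o => (w + z) * (w - z)^-1)).
move=> w; rewrite normr1 => w1.
apply: derivable_continuousC; apply: (@derivableM_num R[i]).
  apply: (@derivableD_num R[i]); first exact: (@derivable_id_num R[i]).
  exact: (@derivable_cst_num R[i]).
apply: (@derivableV_num R[i] (fun w => w - z)).
  by rewrite subr_eq0; apply: contraTneq z1 => <-; rewrite w1 ltxx.
apply: (@derivableB_num R[i]); first exact: (@derivable_id_num R[i]).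
exact: (@derivable_cst_num R[i]).
Qed.

Lemma poisson_kernel_total z : modulus z < 1 ->
  segment_integral 0 (2 * pi) (poisson_kernel ^~ z) = 2 * pi.
Proof.
move=> z1; have tp := two_pi_gt0 (R := R).
have M := @cauchy_kernel_mean R z 2 1 z1.
(* The Herglotz kernel is twice the Cauchy kernel minus 1, whence the constant 2 given to
   [cauchy_kernel_mean]. *)
have E : (fun t => complex.Re (2 * (1%:C * cis t / (1%:C * cis t - z)))) =
    fun t => poisson_kernel t z + 1.
  apply/funext => t; rewrite rmorph1 mul1r /poisson_kernel.
  have -> : 2 * (cis t / (cis t - z)) = (cis t + z) / (cis t - z) + 1.
    by field; exact: cis_sub_neq0.
  by rewrite raddfD.
move: M; rewrite circle_integralE E segment_integralD; last 2 first.
- exact: continuous_poisson_kernel.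
- exact: continuous_between_cst.
have -> : complex.Re (2 : R[i]) = 2 by rewrite raddfMn.
by rewrite (segment_integral_cst _ (ltW tp)); lra.
Qed.

Lemma poisson_integrable (w : R -> R) z : modulus z < 1 ->
  mu.-integrable `[0, 2 * pi] (EFin \o w) ->
  mu.-integrable `[0, 2 * pi] (EFin \o (fun t => poisson_kernel t z * w t)).
Proof.
move=> z1 iw.
have ik := continuous_between_integrable (@continuous_poisson_kernel z 0 (2 * pi) z1).
have /measurable_EFinP mk := measurable_int _ ik.
have bk : [bounded poisson_kernel t z | t in `[0, 2 * pi]%classic].
  exists (2 / (1 - modulus z)); split; first by rewrite num_real.
  move=> x xl t _ /=; rewrite ger0_norm ?poisson_kernel_ge0//.
  by rewrite (le_trans (poisson_kernel_le _ z1))// ltW.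
exact: (@integrableMr _ _ _ mu _ (measurable_itv _) _ _ mk bk iw).
Qed.

Lemma measurable_poisson_pair (g : R -> R[i]) :
  (forall x, modulus (g x) < 1) ->
  continuous (fun x => complex.Re (g x)) -> continuous (fun x => complex.Im (g x)) ->
  measurable_fun [set: R * R] (fun p : R * R => poisson_kernel p.2 (g p.1)).
Proof.
move=> g1 cRe cIm.
have mRe := continuous_measurable_fun cRe.
have mIm := continuous_measurable_fun cIm.
have mcos := continuous_measurable_fun (@continuous_cos R).
have msin := continuous_measurable_fun (@continuous_sin R).
(* The denominator is positive, so its inverse is [expR (- ln _)], a composition of measurable
   functions. *)
have -> : (fun p : R * R => poisson_kernel p.2 (g p.1)) =
  (fun p => (1 - (complex.Re (g p.1) ^+ 2 + complex.Im (g p.1) ^+ 2)) *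
    expR (- ln ((cos p.2 - complex.Re (g p.1)) ^+ 2 +
                (sin p.2 - complex.Im (g p.1)) ^+ 2))).
  apply/funext => -[x t] /=; rewrite poisson_kernelE modulus_sqr; congr (_ * _).
  have -> : (cos t - complex.Re (g x)) ^+ 2 + (sin t - complex.Im (g x)) ^+ 2 =
      modulus (cis t - g x) ^+ 2 by rewrite modulus_sqr !raddfB.
  by rewrite expRN lnK// posrE exprn_gt0// modulus_gt0 cis_sub_neq0.
have m1 : measurable_fun [set: R * R] (fun p : R * R => complex.Re (g p.1)).
  exact: (measurableT_comp mRe measurable_fst).
have m2 : measurable_fun [set: R * R] (fun p : R * R => complex.Im (g p.1)).
  exact: (measurableT_comp mIm measurable_fst).
have m3 : measurable_fun [set: R * R] (fun p : R * R => cos p.2).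
  exact: (measurableT_comp mcos measurable_snd).
have m4 : measurable_fun [set: R * R] (fun p : R * R => sin p.2).
  exact: (measurableT_comp msin measurable_snd).
apply: measurable_funM.
  by apply: measurable_funB => //; apply: measurable_funD; exact: measurable_funX.
apply: measurableT_comp => //; apply: measurableT_comp => //.
apply: measurableT_comp; first exact: measurable_ln.
by apply: measurable_funD; apply: measurable_funX; exact: measurable_funB.
Qed.

End PoissonKernel.

Section PoissonTruncation.
Context {R : realType}.
Implicit Types (f F : R[i]^o -> R[i]^o) (z : R[i]^o) (t r : R).
Local Notation mu := (@lebesgue_measure R).
Local Notation I := (`[0, 2 * pi]%classic : set R).

Lemma segment_integralEFin a b (g : R -> R) : continuous_between a b g ->
  (\int[mu]_(x in `[a, b]) (g x)%:E = (segment_integral a b g)%:E)%E.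
Proof.
move=> cg; rewrite /segment_integral /Rintegral fineK//.
by apply: integrable_fin_num => //; exact: continuous_between_integrable.
Qed.

(** After the exchange of integrals, the inner one is the circle mean of the real part of a
    holomorphic function, namely [2 * pi] times the kernel at [F 0]. The result no longer involves
    [r]. *)
Lemma poisson_tonelli (W : R -> R) F r : measurable_fun setT W ->
  (forall t, 0 <= W t) -> holomorphic_off 1 [::] F ->
  (forall z, modulus z < 1 -> modulus (F z) < 1) -> 0 <= r < 1 ->
  let E (x : R) : \bar R := (\int[mu]_t (poisson_kernel t (F (r%:C * cis x)) * W t)%:E)%E in
  measurable_fun setT E /\
  (\int[mu]_(x in I) E x =
   \int[mu]_t ((2 * pi) * (poisson_kernel t (F 0) * W t))%:E)%E.
Proof.
move=> mW W0 hF F1 r1 E.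
pose g (x : R) : R[i]^o := F (r%:C * cis x).
have polar1 x : modulus (r%:C * cis x) < 1 by rewrite modulus_polar ger0_norm; lra.
have g1 x : modulus (g x) < 1 by exact: F1.
have cg (x : R) : {for x, continuous g}.
  exact: (proj1 (continuous_polar (hF.1 _ (polar1 x)))).
have cRe : continuous (fun x => complex.Re (g x)).
  by move=> x; exact: (@cvg_Re R _ _ _ g (g x) (cg x)).
have cIm : continuous (fun x => complex.Im (g x)).
  move=> x; apply/cvgrPdist_lt => e e0.
  move/ccvgrP : (cg x) => /(_ e e0); apply: filterS => y.
  apply: le_lt_trans; rewrite (le_trans _ (ler_Im_modulus _))//.
  by rewrite raddfB.
have mk := measurable_poisson_pair g1 cRe cIm.
have mKW : measurable_fun [set: R * R]
    (fun p : R * R => (poisson_kernel p.2 (g p.1) * W p.2)%:E).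
  apply/measurable_EFinP; apply: measurable_funM => //.
  exact: measurableT_comp.
have K0 (p : R * R) : (0 <= (poisson_kernel p.2 (g p.1) * W p.2)%:E)%E.
  by rewrite lee_fin mulr_ge0// poisson_kernel_ge0.
split; first exact: (@measurable_fun_fubini_tonelli_F _ _ _ _ R mu _ mKW K0).
pose K (p : R * R) : \bar R := (\1_I p.1 * (poisson_kernel p.2 (g p.1) * W p.2))%:E.
have mK : measurable_fun [set: R * R] K.
  apply/measurable_EFinP; apply: measurable_funM; last exact/measurable_EFinP.
  apply: (measurableT_comp _ measurable_fst).
  by apply: measurable_indic; exact: measurable_itv.
have KK0 p : (0 <= K p)%E.
  by rewrite lee_fin mulr_ge0// mulr_ge0// poisson_kernel_ge0.
rewrite integral_mkcond; transitivity (\int[mu]_x \int[mu]_t K (x, t))%E.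
  apply: eq_integral => x _; rewrite patchE; case: ifPn => xI.
    by apply: eq_integral => t _; rewrite /K indicE xI mul1r.
  by rewrite integral0_eq// => t _; rewrite /K indicE (negbTE xI) mul0r.
transitivity (\int[mu]_t \int[mu]_x K (x, t))%E.
  exact: (@fubini_tonelli _ _ _ _ R mu mu K mK KK0).
apply: eq_integral => t _.
transitivity (\int[mu]_(x in I) (W t * poisson_kernel t (g x))%:E)%E.
  rewrite [RHS]integral_mkcond; apply: eq_integral => x _; rewrite patchE /K indicE.
  by case: ifPn => xI; rewrite ?mul1r ?mul0r// mulrC.
have cpk := @continuous_poisson_kernel_comp R F t r 0 (2 * pi) hF F1 r1.
rewrite segment_integralEFin; last first.
  by move=> x xI; apply: cvgM; [exact: cvg_cst|exact: cpk].
by rewrite segment_integralZ// poisson_kernel_mean//; congr EFin; ring.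
Qed.

(* Splitting [w] at height [M] bounds its Poisson integral by [M], up to a
   function whose circle means are small uniformly in the radius. *)
Lemma poisson_truncation (w : R -> R) F (e : R) :
  mu.-integrable I (EFin \o w) -> holomorphic_off 1 [::] F ->
  (forall z, modulus z < 1 -> modulus (F z) < 1) -> 0 < e ->
  exists2 M : R, 0 <= M & forall r, 0 <= r < 1 -> exists E : R -> \bar R,
    [/\ measurable_fun setT E, forall x, (0 <= E x)%E,
      forall x, ((segment_integral 0 (2 * pi) (fun t =>
        poisson_kernel t (F (r%:C * cis x)) * w t))%:E <= (M * (2 * pi))%:E + E x)%E
    & (\int[mu]_(x in I) E x <= e%:E)%E].
Proof.
move=> iw hF F1 e0; have tp := two_pi_gt0 (R := R).
have F01 : modulus (F 0) < 1 by apply: F1; rewrite modulus0.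
have mI : measurable I by exact: measurable_itv.
have /measurable_EFinP mw := measurable_int _ iw.
(* The excess of [w] over the height [n], extended by 0 to the line. For each [t] it vanishes for
   large [n], and it is at most [|w|]. *)
pose W (n : nat) := (fun t => Num.max (w t - n%:R) 0) \_ I.
have W0 n t : 0 <= W n t.
  by rewrite /W patchE; case: ifPn => // _; rewrite le_max lexx orbT.
have mW n : measurable_fun setT (W n).
  apply/(measurable_restrict _ _ _) => //; rewrite setTI.
  apply: measurable_maxr => //; apply: measurable_funB => //.
have iW n : mu.-integrable I (EFin \o (fun t => Num.max (w t - n%:R) 0)).
  apply: (@le_integrable _ _ _ mu _ mI _ _ _ _ iw).
    by apply/measurable_EFinP; apply: measurable_maxr => //; exact: measurable_funB.
  move=> t _; rewrite /= lee_fin [X in X <= _]ger0_norm ?le_max ?lexx ?orbT//.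
  rewrite ge_max normr_ge0 andbT (le_trans _ (ler_norm _))// gerBl ler0n//.
have mpk : measurable_fun setT (poisson_kernel ^~ (F 0)).
  apply: continuous_measurable_fun => t.
  by apply: (@continuous_poisson_kernel R (F 0) t t F01); rewrite lexx.
have ipw := poisson_integrable F01 iw.
have tail : (\int[mu]_t ((2 * pi) * (poisson_kernel t (F 0) * W n t))%:E)%E
    @[n --> \oo] --> 0%E.
  pose fn (n : nat) (t : R) : \bar R := ((2 * pi) * (poisson_kernel t (F 0) * W n t))%:E.
  pose dom : R -> \bar R :=
    (fun t => ((2 * pi) * `|poisson_kernel t (F 0) * w t|)%:E) \_ I.
  have mfn n : measurable_fun setT (fn n).
    apply/measurable_EFinP; apply: measurable_funM => //.
    by apply: measurable_funM.
  have cv_ae : {ae mu, forall t, setT t -> fn n t @[n --> \oo] --> 0%E}.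
    apply: aeW => t _; apply: cvg_near_cst.
    have [n0 wn] : exists n0 : nat, w t < n0%:R.
      by exists (Num.truncn (Num.max (w t) 0)).+1;
        apply: (@le_lt_trans _ _ (Num.max (w t) 0)); [rewrite le_max lexx|exact: truncnS_gt].
    exists n0 => // n /= n0n; rewrite /fn /W patchE; case: ifPn => _; last by rewrite !mulr0.
    rewrite max_r ?mulr0// subr_le0 (le_trans (ltW wn))// ler_nat//.
  have idom : mu.-integrable setT dom.
    rewrite /dom -integrable_mkcond//.
    have := @integrableZl _ _ _ mu _ mI (2 * pi) _ (integrable_abse ipw).
    by [].
  have dom_ae : {ae mu, forall t (n : nat), setT t -> (`|fn n t| <= dom t)%E}.
    apply: aeW => t n _; rewrite /fn /dom patchE /W patchE; case: ifPn => tI; last first.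
      by rewrite !mulr0 abse0.
    rewrite lee_fin normrM (ger0_norm (ltW tp)) ler_pM2l// !normrM ler_wpM2l//.
    rewrite ger0_norm ?le_max ?lexx ?orbT//.
    by rewrite ge_max normr_ge0 andbT (le_trans _ (ler_norm _))// gerBl ler0n.
  have [_ _] := @dominated_convergence _ _ R mu setT measurableT fn (fun=> 0%E)
    dom mfn (measurable_cst _) cv_ae idom dom_ae.
  by rewrite integral0.
(* Only [F 0] enters here, so [N] is fixed before [r]. *)
have [N eN] : exists N, (\int[mu]_t ((2 * pi) *
    (poisson_kernel t (F 0) * W N t))%:E <= e%:E)%E.
  have /fine_cvgP[[N1 _ H1] /cvgr_lt/(_ e e0)[N2 _ H2]] := tail.
  have {}H1 := H1 (N1 + N2)%N (leq_addr _ _).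
  have {}H2 := H2 (N1 + N2)%N (leq_addl _ _).
  by exists (N1 + N2)%N; rewrite -(fineK H1) lee_fin ltW.
(* [E] is the Poisson integral of the excess. As [w] is at most [N] plus the excess, the mass
   [2 * pi] of the kernel accounts for the other term. *)
exists N%:R => // r r1.
have [mE intE] := poisson_tonelli (mW N) (W0 N) hF F1 r1.
eexists; split; first exact: mE.
- move=> x; apply: integral_ge0 => t _; rewrite lee_fin mulr_ge0// poisson_kernel_ge0//.
  by apply: F1; rewrite modulus_polar ger0_norm; lra.
- move=> x; have z1 : modulus (F (r%:C * cis x)) < 1.
    by apply: F1; rewrite modulus_polar ger0_norm; lra.
  set z := F _ in z1 *.
  have i1 := poisson_integrable z1 iw; have i2 := poisson_integrable z1 (iW N).
  have ik := continuous_between_integrable (@continuous_poisson_kernel R z 0 (2 * pi) z1).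
  have -> : (\int[mu]_t (poisson_kernel t z * W N t)%:E)%E =
      (segment_integral 0 (2 * pi) (fun t =>
        poisson_kernel t z * Num.max (w t - N%:R) 0))%:E.
    rewrite /segment_integral /Rintegral fineK; last exact: integrable_fin_num.
    rewrite [RHS]integral_mkcond; apply: eq_integral => t _.
    by rewrite /W !patchE; case: ifPn => // _; rewrite mulr0.
  rewrite -EFinD lee_fin -[X in _ * X + _](poisson_kernel_total z1).
  have iZ := @integrableZl _ _ _ mu _ mI N%:R _ ik.
  have iD := @integrableD _ _ _ mu _ mI _ _ iZ i2.
  rewrite /segment_integral -RintegralZl// -RintegralD//.
  apply: (@le_Rintegral _ _ _ mu I _ _ mI i1 iD) => t _.
  rewrite [N%:R * _]mulrC -mulrDr ler_wpM2l ?poisson_kernel_ge0//.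
  by rewrite -lerBlDl le_max lexx.
- by rewrite intE.
Qed.

End PoissonTruncation.

(** * Outer functions *)

Section OuterFunctions.
Context {R : realType}.
Implicit Types (f g h k phi psi : R[i]^o -> R[i]^o) (z : R[i]^o) (t r : R).
Local Notation mu := (@lebesgue_measure R).
Local Notation I := (`[0, 2 * pi]%classic : set R).

Lemma modulus_cexp z : modulus (cexp z) = expR (complex.Re z).
Proof. by rewrite modulus_polar ger0_norm// expR_ge0. Qed.

(** The real part of the exponent is a Poisson integral. In particular an outer function has no
    zero. *)
Lemma outer_modulus g : outer g -> exists2 u : R -> R,
  mu.-integrable I (EFin \o u) &
  forall z, modulus z < 1 -> modulus (g z) = expR ((2 * pi)^-1 *
    segment_integral 0 (2 * pi) (fun t => poisson_kernel t z * u t)).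
Proof.
move=> [_ [G [G0 iG gE]]]; exists (fun t => ln (G (cis t))).
  have Gt t : 0 <= G (cis t).
    by apply: G0; rewrite normcE modulus_cis.
  (* Default values agree where [G] vanishes: [ln 0] and [fine -oo] are both 0. Integrability then
     passes to [ln], since [fine] does not increase absolute values. *)
  have uE t : ln (G (cis t)) = fine (lne (G (cis t))%:E).
    have := Gt t; rewrite le_eqVlt => /predU1P[<-|Gp]; last by rewrite lne_EFin.
    by rewrite ln0// le0_lneNy.
  have mI : measurable I by exact: measurable_itv.
  have mG := measurable_int _ iG.
  apply: (@le_integrable _ _ _ mu _ mI _ _ _ _ iG).
    apply/measurable_EFinP.
    have -> : (fun t => ln (G (cis t))) = fine \o (fun t => lne (G (cis t))%:E).
      exact/funext.
    exact: (measurableT_comp (@fine_measurable R setT measurableT) mG).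
  move=> t _; rewrite [(EFin \o _) t](_ : _ = (fine (lne (G (cis t))%:E))%:E).
    by case: (lne _) => [x| |]; rewrite ?lexx// ?normr0 ?leey.
  by rewrite -uE.
move=> z z1; rewrite gE ?diskE// modulus_cexp RemulC; congr expR; congr (_ * _).
rewrite /integral_0_2pi /segment_integral; congr Rintegral.
by apply/funext => t; rewrite mulrC RemulC mulrC.
Qed.

Lemma minr_continuous (c : R) : continuous (fun x : R => Num.min x c).
Proof.
have -> : (fun x : R => Num.min x c) = (fun x => (x + c - `|x - c|) / 2).
  apply/funext => x; have [xc|cx] := leP x c.
    by rewrite ler0_norm ?subr_le0//; lra.
  by rewrite gtr0_norm ?subr_gt0//; lra.
move=> x; apply: cvgM; last exact: cvg_cst.
apply: cvgB; first by apply: cvgD; [exact: cvg_id|exact: cvg_cst].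
by apply: cvg_norm; apply: cvgB; [exact: cvg_id|exact: cvg_cst].
Qed.

(* Both logarithms [ln |g|] and [ln |k \o phi|] are bounded, up to functions
   with small circle means, so [- ln |psi|] is uniformly integrable on circles.
   Its circle means are at least [- ln |psi 0|], and it tends to 0 radially. *)
Lemma outer_inner_factor psi phi h k g : inner psi ->
  holomorphic_off 1 [::] phi -> (forall z, modulus z < 1 -> modulus (phi z) < 1) ->
  (forall z, modulus z < 1 -> modulus (h z) <= 1) -> outer k -> outer g ->
  (forall z, modulus z < 1 -> g z = psi z * (h (phi z) * k (phi z))) ->
  unimodular_constant psi.
Proof.
move=> ipsi hphi dphi h1 /outer_modulus[v iv kE] /outer_modulus[u iu gE] gpsi.
have tp := two_pi_gt0 (R := R).
have psi1 := inner_le1 ipsi.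
have hpsi : holomorphic_off 1 [::] psi by case: ipsi => hp _ _; exact: holomorphicW.
(* [psi] is a factor of [g], which has no zero. *)
have psin z : modulus z < 1 -> psi z != 0.
  move=> z1; have : modulus (g z) != 0 by rewrite gE// gt_eqF// expR_gt0.
  by rewrite modulus_eq0 gpsi// mulf_eq0 => /norP[].
suff psi01 : modulus (psi 0) = 1.
  exists (psi 0); first by rewrite normcE psi01.
  by move=> z; rewrite inE diskE => z1; exact: (center_maximum hpsi psi1 psi01 z1).
apply/eqP; rewrite eq_le psi1 ?modulus0//= leNgt; apply/negP => psi0.
have m0 : 0 < modulus (psi 0) by rewrite modulus_gt0 psin// modulus0.
pose L := - ln (modulus (psi 0)); have L0 : 0 < L.
  by rewrite oppr_gt0 ln_lt0// m0.
(* Two errors [e], divided by [2 * pi], make [pi * L]: half of the lower bound [2 * pi * L] that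
   Jensen's inequality gives for the circle integrals of [- ln |psi|]. *)
pose e := pi * (pi * L); have e0 : 0 < e by rewrite !mulr_gt0// pi_gt0.
have inu : mu.-integrable I (EFin \o (fun t => - u t)).
  by have := integrableN iu.
have hid : holomorphic_off 1 [::] (id : R[i]^o -> R[i]^o) by exact: holomorphic_off_id.
have [M1 M10 P1] := poisson_truncation iv hphi dphi e0.
have did z : modulus z < 1 -> modulus (id z) < 1 by [].
have [M2 M20 P2] := poisson_truncation inu hid did e0.
pose C := M1 + M2; have C0 : 0 <= C by rewrite addr_ge0.
pose rad (n : nat) : R := 1 - n.+2%:R^-1.
have radP n : 0 < rad n < 1 by exact: radius_itv.
pose N n t := 0 - ln (modulus (psi ((rad n)%:C * cis t))).
have polar1 n t : modulus ((rad n)%:C * cis t) < 1.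
  by rewrite modulus_polar; have := radP n => ?; rewrite gtr0_norm; lra.
have cln n : continuous_between 0 (2 * pi)
    (fun t => ln (modulus (psi ((rad n)%:C * cis t)))).
  apply: continuous_between_ln_modulus => z zr.
    by apply: hpsi.1; rewrite zr; have := radP n => ?; rewrite gtr0_norm; lra.
  by apply: psin; rewrite zr; have := radP n => ?; rewrite gtr0_norm; lra.
have cN n : continuous_between 0 (2 * pi) (N n).
  by apply: continuous_betweenB; [exact: continuous_between_cst|exact: cln].
have N0 n t : 0 <= N n t.
  by rewrite /N sub0r oppr_ge0 ln_le0// psi1.
(* The cut at [C] makes bounded convergence applicable; what it removes from [N] is at most
   [(E1 + E2) / (2 * pi)]. *)
pose T n t := Num.min (N n t) C.
have cT n : continuous_between 0 (2 * pi) (T n).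
  by move=> t tI; exact: (cvg_comp _ _ (cN n t tI) (@minr_continuous C (N n t))).
have T0 n t : 0 <= T n t by rewrite le_min N0 C0.
have TC n t : 0 <= t <= 2 * pi -> `|T n t| <= C.
  by move=> _; rewrite ger0_norm// ge_min lexx orbT.
have Tlim : \forall t \ae mu, t \in `[0, 2 * pi] -> T n t @[n --> \oo] --> (0 : R).
  have := inner_radial ipsi; apply: lebesgue_ae_imply => t tl tI.
  have psiR : (fun n => modulus (psi ((rad n)%:C * cis t))) @ \oo --> (1 : R).
    exact: (cvg_comp _ _ radius_cvg (tl tI)).
  have lnR := cvg_comp _ _ psiR (continuous_ln (ltr01 : 0 < 1 :> R)).
  have NR : (fun n => N n t) @ \oo --> (0 : R).
    rewrite -[X in _ --> X](subrr (0 : R)); apply: cvgB; first exact: cvg_cst.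
    by rewrite -[X in _ --> X]ln1; exact: lnR.
  have := cvg_comp _ _ NR (@minr_continuous C 0).
  by rewrite min_l.
have Tcvg := bounded_convergence cT TC Tlim.
(* This contradicts [Tcvg], by which these integrals tend to 0. *)
have bound n : pi * L <= segment_integral 0 (2 * pi) (T n).
  have /andP[r0 r1] := radP n; have r01 : 0 <= rad n < 1 by rewrite ltW.
  have [E1 [mE1 E10 V1 I1]] := P1 _ r01; have [E2 [mE2 E20 V2 I2]] := P2 _ r01.
  have mI : measurable I by exact: measurable_itv.
  have NP t : ((N n t)%:E <= (T n t)%:E + ((2 * pi)^-1)%:E * (E1 t + E2 t))%E.
    have z1 := polar1 n t; set z := _ * cis t in z1.
    have pz := dphi _ z1.
    pose V := segment_integral 0 (2 * pi) (fun x => poisson_kernel x (phi z) * v x).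
    pose U := segment_integral 0 (2 * pi) (fun x => poisson_kernel x z * u x).
    have UN : segment_integral 0 (2 * pi) (fun x => poisson_kernel x z * - u x) = - U.
      rewrite /U -mulN1r /segment_integral -RintegralZl//; last first.
        exact: poisson_integrable z1 iu.
      by apply: eq_Rintegral => x _; rewrite mulrN mulN1r.
    (* Logarithm of [|g| <= |psi| * |k (phi z)|], which holds because [|h| <= 1]. *)
    have NUV : N n t <= (2 * pi)^-1 * (V - U).
      rewrite /N sub0r mulrBr lerNl opprB lerBlDr.
      rewrite -ler_expR expRD lnK ?posrE ?modulus_gt0 ?psin// -gE// -kE//.
      rewrite gpsi// !modulusM ler_wpM2l ?modulus_ge0//.
      by rewrite ler_piMl ?modulus_ge0// h1.
    have := V1 t; have := V2 t; rewrite UN -/z -/V => B2 B1.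
    rewrite /T; have [NC|CN] := leP (N n t) C.
      by rewrite leeDl// mule_ge0 ?adde_ge0// lee_fin invr_ge0 ltW.
    apply: (@le_trans _ _ ((2 * pi)^-1 * (V - U))%:E); first by rewrite lee_fin.
    have VU : ((V - U)%:E <= (C * (2 * pi))%:E + (E1 t + E2 t))%E.
      by rewrite EFinD /C mulrDl EFinD addeACA leeD.
    have -> : C = (2 * pi)^-1 * (C * (2 * pi)) by rewrite mulrC mulfK ?gt_eqF.
    rewrite [X in (_ <= X + _)%E]EFinM -muleDr// [X in (X <= _)%E]EFinM.
    by rewrite lee_pmul2l// lte_fin invr_gt0.
  have mT : measurable_fun I (fun t => (T n t)%:E).
    exact: measurable_int (continuous_between_integrable (cT n)).
  have mN : measurable_fun I (fun t => (N n t)%:E).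
    exact: measurable_int (continuous_between_integrable (cN n)).
  have mE1' := measurable_funTS (D := I) mE1.
  have mE2' := measurable_funTS (D := I) mE2.
  have mE12 : measurable_fun I (fun t => E1 t + E2 t)%E by exact: emeasurable_funD.
  have ip0 : 0 <= (2 * pi)^-1 :> R by rewrite invr_ge0 ltW.
  have H : ((segment_integral 0 (2 * pi) (N n))%:E <=
      (segment_integral 0 (2 * pi) (T n))%:E + ((2 * pi)^-1)%:E * (e%:E + e%:E))%E.
    rewrite -!segment_integralEFin//.
    apply: (@le_trans _ _
      (\int[mu]_(t in I) ((T n t)%:E + ((2 * pi)^-1)%:E * (E1 t + E2 t)))%E).
      have mR : measurable_fun I
          (fun t => (T n t)%:E + ((2 * pi)^-1)%:E * (E1 t + E2 t))%E.
        by apply: emeasurable_funD; [exact: mT|exact: measurable_funeM].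
      apply: (@ge0_le_integral _ _ _ mu I mI _ _ _ mN mR) => t _ //.
      by rewrite lee_fin.
    rewrite (@ge0_integralD _ _ _ mu I mI)//; last 3 first.
    - by move=> t _; rewrite lee_fin.
    - by move=> t _; rewrite mule_ge0 ?adde_ge0// lee_fin.
    - exact: measurable_funeM.
    rewrite leeD2l// (@ge0_integralZl _ _ _ mu I mI)//; last first.
      by move=> t _; rewrite adde_ge0.
    by rewrite lee_wpmul2l// (@ge0_integralD _ _ _ mu I mI)// leeD.
  have J := jensen_zero_free hpsi psi1 psin (radP n).
  have NE : segment_integral 0 (2 * pi) (N n) = 0 - segment_integral 0 (2 * pi)
      (fun t => ln (modulus (psi ((rad n)%:C * cis t)))).
    rewrite segment_integralB//; last exact: continuous_between_cst.
    by rewrite segment_integral_cst ?ltW// mul0r.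
  have {H} : segment_integral 0 (2 * pi) (N n) <=
      segment_integral 0 (2 * pi) (T n) + (2 * pi)^-1 * (e + e).
    by rewrite -lee_fin EFinD EFinM.
  rewrite NE.
  have -> : (2 * pi)^-1 * (e + e) = pi * L.
    have p0 : pi != 0 :> R by rewrite gt_eqF ?pi_gt0.
    have E (p : R) : p != 0 -> (2 * p)^-1 * (p * (p * L) + p * (p * L)) = p * L.
      by move=> pn; field.
    exact: E.
  by move: J; rewrite /L; lra.
have piL : 0 < pi * L by rewrite mulr_gt0// pi_gt0.
rewrite mul0r in Tcvg; have /cvgr_lt/(_ _ piL)[n _ /(_ n (leqnn n)) /=] := Tcvg.
by rewrite ltNge bound.
Qed.

End OuterFunctions.

Theorem theorem1p3 (R : realType) (X : completeNormedModType R[i])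
    (iota : {linear X -> (R[i]^o -> R[i]^o)})
    (T : {linear X -> (R[i]^o -> R[i]^o)})
    (phi psi : R[i]^o -> R[i]^o) :
  function_space iota ->
  inclusion_continuous iota ->
  polynomials_dense iota ->
  monomial_growth iota ->
  (forall f, holomorphic (T f)) ->
  continuous (T : X -> compact_convergence R) ->
  (forall f, finite_blaschke (iota f) -> inner (T f)) ->
  dim_gt 1 (range T) ->
  inner phi -> ~ constant_on_disk phi -> inner psi ->
  (forall f, eq_disk (T f) (fun z => psi z * iota f (phi z))) ->
  ((exists2 f, smirnov (iota f) & outer (T f)) -> unimodular_constant psi) /\
  ((exists2 f, smirnov (iota f) & outer (T f)) ->
   separates_points (range T) -> disk_automorphism phi).
Proof.
move=> _ _ _ _ _ _ _ _ iphi nphi ipsi TE.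
have dphi := inner_nonconstant iphi nphi.
have hphi : holomorphic_off 1 [::] phi by case: iphi => h _ _; exact: holomorphicW.
have TEz f z : modulus z < 1 -> T f z = psi z * iota f (phi z).
  by move=> z1; apply: TE; rewrite inE diskE.
have part1 : (exists2 f, smirnov (iota f) & outer (T f)) -> unimodular_constant psi.
  move=> [f [[h [k [ih ok fE]]]|f0] og].
    apply: (outer_inner_factor ipsi hphi dphi (inner_le1 ih) ok og) => z z1.
    by rewrite TEz// fE// inE diskE; exact: dphi.
  (* The zero function of the Smirnov class: [T f] would vanish at 0, but it is outer. *)
  have o1 : modulus (0 : R[i]) < 1 by rewrite modulus0.
  have [u _ /(_ 0 o1)] := outer_modulus og.
  rewrite TEz// f0 ?inE ?diskE; last exact: dphi.
  by rewrite mulr0 modulus0 => /eqP; rewrite lt_eqF// expR_gt0.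
split=> // fT sep; have [c c1 psiE] := part1 fT.
(* With [psi] constant, [T f z] depends on [z] only through [phi z], so points with the same image
   under [phi] could not be separated. *)
apply: injective_inner_automorphism => // z w z1 w1 zw.
apply: contrapT => nzw; have [||_ [f _ <-]] := sep z w _ _ nzw; rewrite ?diskE//.
by apply; rewrite !TEz// zw !psiE// inE diskE.
Qed.
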